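(* Let $\mu$ be an inductive valuation and consider two MacLane chains of $\mu$ of length $r\ge1$ that differ only in the key polynomial of the last step: $$\mu_0\xrightarrow{\phi_1,\nu_1}\cdots\xrightarrow{\phi_{r-1},\nu_{r-1}}\mu_{r-1}\xrightarrow{\phi_r,\nu_r}\mu,\qquad \mu_0\xrightarrow{\phi_1,\nu_1}\cdots\xrightarrow{\phi_{r-1},\nu_{r-1}}\mu_{r-1}\xrightarrow{\phi^*_r,\nu_r}\mu,$$ marking with $*$ the data and operators of the second. If $\phi^*_r\sim_\mu\phi_r$, then $p^*_r=p_r$, $x^*_r=x_r$, $y^*_r=y_r$, $S^*_{\nu_r}(g)=S_{\nu_r}(g)$ for all nonzero $g\in K[x]$, and $R^*_r=R_r$. If $\phi^*_r\not\sim_\mu\phi_r$, let $\eta:=R_r(\phi^*_r-\phi_r)\in\mathbb F_\mu^*$; then $p^*_r=p_r$, $x^*_r=x_r+p_r^{h_r}\eta$, $y^*_r=y_r+\eta$, and for every nonzero $g\in K[x]$, setting $s:=\mathrm{ord}_{y+\eta}R_r(g)$ and $P(g):=R_r(g)/(y+\eta)^s$, we have $s^*_r(g)=s$ and $R^*_r(g)(y)=(y-\eta)^{s_r(g)}P(g)(y-\eta)$.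
   Context: Let $K$ be a field with a surjective discrete valuation $v\colon K^*\to\mathbb Z$, a fixed generator $\pi$ of its maximal ideal, residue field $\mathbb F$. Valuations $\mu$ on $K(x)$ extend $v$ with $\mu(x)\ge0$; Gauss valuation $\mu_0(\sum a_sx^s)=\min v(a_s)$; $\Gamma(\mu)=\mu(K(x)^* )$, $e(\mu)\Gamma(\mu)=\mathbb Z$; $\mathcal P_\alpha=\{g:\mu(g)\ge\alpha\}\supset\mathcal P_\alpha^+=\{g:\mu(g)>\alpha\}$, $\mathcal{G}r(\mu)=\bigoplus_\alpha\mathcal P_\alpha/\mathcal P^+_\alpha$, $\Delta(\mu)=\mathcal P_0/\mathcal P_0^+$, $H_\mu(g)$ the class of $g\ne0$ in $\mathcal P_{\mu(g)}/\mathcal P^+_{\mu(g)}$; canonical maps $\mathcal{G}r(\mu)\to\mathcal{G}r(\mu')$ for $\mu\le\mu'$. $g\sim_\mu h$ means $H_\mu(g)=H_\mu(h)$; $\phi\mid_\mu g$ means $H_\mu(\phi)\mid H_\mu(g)$. Key polynomials for $\mu$: monic $\phi$ with $H_\mu(\phi)\mathcal{G}r(\mu)$ nonzero prime and $\phi\nmid_\mu h$ for nonzero $h$ of smaller degree. Augmentation $[\mu;\phi,\nu](\sum a_s\phi^s)=\min_s\{\mu(a_s\phi^s)+s\nu\}$. MacLane chain: $\mu_i=[\mu_{i-1};\phi_i,\nu_i]$ with $\phi_i$ key for $\mu_{i-1}$, $\nu_i>0$, $\phi_{i+1}\nmid_{\mu_i}\phi_i$. Data: $\phi_0=x,\nu_0=0,\mu_{-1}=\mu_0$;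 $\Delta_i=\Delta(\mu_i)$, $\mathbb F_0=\mathbb F$, $\mathbb F_i=\mathrm{Im}(\Delta_{i-1}\to\Delta_i)$, and $\mathbb F_\mu:=\mathbb F_r$; $e_i=e(\mu_i)/e(\mu_{i-1})$, $h_i=e(\mu_i)\nu_i$, $V_i=e(\mu_{i-1})\mu_{i-1}(\phi_i)$, $\ell_ih_i+\ell'_ie_i=1$, $0\le\ell_i<e_i$; $p_0=H_{\mu_0}(\pi)$, $x_i=H_{\mu_i}(\phi_i)p_i^{-V_i}$, $y_i=x_i^{e_i}p_i^{-h_i}\in\Delta_i$, $p_{i+1}=x_i^{\ell_i}p_i^{\ell'_i}$; $y_i$ is transcendental over $\mathbb F_i$, $\Delta_i=\mathbb F_i[y_i]$. $N_i(g)$: lower convex hull of $\{(s,\mu_{i-1}(a_s\phi_i^s))\}$ for the $\phi_i$-expansion $g=\sum a_s\phi_i^s$ ($\deg a_s<\deg\phi_i$). $S_{\nu_i}(g)$ (the $\nu_i$-component) is the intersection of $N_i(g)$ with the line of slope $-\nu_i$ first touching it from below; $(s_i(g),u_i(g)/e(\mu_{i-1}))$ is its left end point. $R_i(g)\in\mathbb F_i[y]$ is the unique polynomial with $H_{\mu_i}(g)=x_i^{s_i(g)}p_i^{u_i(g)}R_i(g)(y_i)$. The quantity $R_r(\phi^*_r-\phi_r)$ is a nonzero constant in this case, regarded as an element of $\mathbb F_r\subset\Delta_r$. *)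

(* Defs.v *)
From HB Require Import structures.
From mathcomp Require Import all_boot all_order all_algebra.
From mathcomp Require Import generic_quotient ring_quotient.
From mathcomp Require Import boolp classical_sets.

Set Implicit Arguments.
Unset Strict Implicit.
Unset Printing Implicit Defensive.

Import Order.TTheory GRing.Theory Num.Theory.
Local Open Scope ring_scope.
Local Open Scope quotient_scope.
Local Open Scope classical_set_scope.

Notation tofrac := (@FracField.tofrac _).
Notation "x %:F" := (tofrac x) : ring_scope.

(* Every valuation takes the value +oo at 0; only the values at nonzero
   elements are recorded, so [v 0] carries no information and is never used. *)
Record valuation (F : fieldType) (G : realDomainType) := Valuation {
  vfun :> F -> G;
  vfunM : forall a b, a != 0 -> b != 0 -> vfun (a * b) = vfun a + vfun b;
  vfunD : forall a b, a != 0 -> b != 0 -> a + b != 0 ->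
    Num.min (vfun a) (vfun b) <= vfun (a + b) }.

Section ValuationTheory.
Variables (F : fieldType) (G : realDomainType) (v : valuation F G).

Lemma vfun1 : v 1 = 0.
Proof.
have /eqP := vfunM v (oner_neq0 F) (oner_neq0 F).
by rewrite mulr1 eq_sym -subr_eq0 addrK => /eqP.
Qed.

Lemma vfunN a : v (- a) = v a.
Proof.
have N1 : -1 != 0 :> F by rewrite oppr_eq0 oner_neq0.
have /eqP := vfunM v N1 N1.
rewrite mulrNN mulr1 vfun1 eq_sym -mulr2n mulrn_eq0 /= => /eqP v1.
have [->|a0] := eqVneq a 0; first by rewrite oppr0.
by rewrite -mulN1r vfunM // v1 add0r.
Qed.

End ValuationTheory.

Section BaseValuation.
Variables (K : fieldType) (v : valuation K int).

Definition in_valuation_ring (a : K) : Prop := a = 0 \/ 0 <= v a.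

Definition in_maximal_ideal (a : K) : Prop := a = 0 \/ 0 < v a.

Definition generates_maximal_ideal (pi : K) : Prop :=
  forall a, in_maximal_ideal a <-> exists2 b, in_valuation_ring b & a = b * pi.

End BaseValuation.

Section GradedAlgebra.
Variables (K : fieldType) (mu : valuation {fraction {poly K}} rat).

(* The filtration is by subsets of K[x], not of K(x). *)
Definition P_ (alpha : rat) : pred {poly K} :=
  [pred g : {poly K} | (g == 0) || (alpha <= mu g%:F)].

Definition Pplus (alpha : rat) : pred {poly K} :=
  [pred g : {poly K} | (g == 0) || (alpha < mu g%:F)].

Lemma tofrac_neq0 (g : {poly K}) : (g%:F != 0) = (g != 0).
Proof. by rewrite tofrac_eq0. Qed.

Lemma P_0 alpha : 0 \in P_ alpha. Proof. by rewrite !inE eqxx. Qed.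
Lemma Pplus0 alpha : 0 \in Pplus alpha. Proof. by rewrite !inE eqxx. Qed.

Lemma P_D alpha f g : f \in P_ alpha -> g \in P_ alpha -> f + g \in P_ alpha.
Proof.
rewrite !inE; have [->|f0] := eqVneq f 0; first by rewrite add0r.
have [->|g0] := eqVneq g 0; first by rewrite addr0 (negPf f0).
have [//|fg0] := eqVneq (f + g) 0; rewrite /= => fP gP.
rewrite tofracD (le_trans _ (vfunD mu _ _ _)) ?tofrac_neq0 //.
  by rewrite le_min fP.
by rewrite -tofracD tofrac_neq0.
Qed.

Lemma PplusD alpha f g :
  f \in Pplus alpha -> g \in Pplus alpha -> f + g \in Pplus alpha.
Proof.
rewrite !inE; have [->|f0] := eqVneq f 0; first by rewrite add0r.
have [->|g0] := eqVneq g 0; first by rewrite addr0 (negPf f0).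
have [//|fg0] := eqVneq (f + g) 0; rewrite /= => fP gP.
rewrite tofracD (lt_le_trans _ (vfunD mu _ _ _)) ?tofrac_neq0 //.
  by rewrite lt_min fP.
by rewrite -tofracD tofrac_neq0.
Qed.

Lemma P_N alpha f : (- f \in P_ alpha) = (f \in P_ alpha).
Proof. by rewrite !inE oppr_eq0 tofracN vfunN. Qed.

Lemma PplusN alpha f : (- f \in Pplus alpha) = (f \in Pplus alpha).
Proof. by rewrite !inE oppr_eq0 tofracN vfunN. Qed.

Lemma PplusP alpha f : f \in Pplus alpha -> f \in P_ alpha.
Proof. by rewrite !inE; case: eqP => //= _ /ltW. Qed.

Lemma P_M alpha beta f g :
  f \in P_ alpha -> g \in P_ beta -> f * g \in P_ (alpha + beta).
Proof.
rewrite !inE mulf_eq0; case: eqVneq => //= f0; case: eqVneq => //= g0 fP gP.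
by rewrite tofracM vfunM ?tofrac_neq0 // lerD.
Qed.

Lemma PplusM alpha beta f g :
  f \in Pplus alpha -> g \in P_ beta -> f * g \in Pplus (alpha + beta).
Proof.
rewrite !inE mulf_eq0; case: eqVneq => //= f0; case: eqVneq => //= g0 fP gP.
by rewrite tofracM vfunM ?tofrac_neq0 // ltr_leD.
Qed.

Lemma PplusMr alpha beta f g :
  f \in P_ alpha -> g \in Pplus beta -> f * g \in Pplus (alpha + beta).
Proof. by move=> fP gP; rewrite mulrC addrC PplusM. Qed.

(* [Gr] is the direct sum of the P_ alpha / Pplus alpha over all rational
   alpha (the summand is 0 for alpha outside the value group).  Its elements
   are the finite formal sums of terms (alpha, g) with g in P_ alpha, two of
   them being identified when, for each alpha, their components of degree
   alpha are congruent modulo Pplus alpha. *)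
Record term := Term { tval :> rat * {poly K}; _ : tval.2 \in P_ tval.1 }.
HB.instance Definition _ := [isSub for tval].
HB.instance Definition _ := [Choice of term by <:].

Definition component (s : seq term) (alpha : rat) : {poly K} :=
  \sum_(t <- s) if (tval t).1 == alpha then (tval t).2 else 0.

Definition gr_rel (s t : seq term) : bool :=
  `[< forall alpha, component s alpha - component t alpha \in Pplus alpha >].

Lemma gr_rel_is_equiv : equiv_class_of gr_rel.
Proof.
split=> [s|s t|t s u].
- by apply/asboolP => a; rewrite subrr Pplus0.
- by apply/asboolP/asboolP => H a; rewrite -PplusN opprB.
- move=> /asboolP H1 /asboolP H2; apply/asboolP => a.
  by have := PplusD (H1 a) (H2 a); rewrite addrA subrK.
Qed.

Canonical gr_rel_equiv := EquivRelPack gr_rel_is_equiv.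

Definition Gr := {eq_quot gr_rel}.
HB.instance Definition _ := Choice.on Gr.
HB.instance Definition _ : EqQuotient _ gr_rel Gr := EqQuotient.on Gr.

Lemma gr_eqP (s t : seq term) :
  reflect (forall alpha, component s alpha - component t alpha \in Pplus alpha)
          (\pi_Gr s == \pi_Gr t).
Proof. by rewrite eqmodE; apply: asboolP. Qed.

Lemma component_eq s t : component s =1 component t -> \pi_Gr s = \pi_Gr t.
Proof. by move=> e; apply/eqP/gr_eqP => a; rewrite e subrr Pplus0. Qed.

Lemma component_in s alpha : component s alpha \in P_ alpha.
Proof.
rewrite /component; elim: s => [|[t tP] s IH]; first by rewrite big_nil P_0.
by rewrite big_cons P_D //=; case: eqP tP => [->|]; rewrite ?P_0.
Qed.

Lemma component_cat s t alpha :
  component (s ++ t) alpha = component s alpha + component t alpha.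
Proof. by rewrite /component big_cat. Qed.

Lemma term_opp_subproof (t : term) : - (tval t).2 \in P_ (tval t).1.
Proof. by rewrite P_N; case: t. Qed.
Definition term_opp (t : term) : term :=
  @Term ((tval t).1, - (tval t).2) (term_opp_subproof t).

Lemma term_mul_subproof (t u : term) :
  (tval t).2 * (tval u).2 \in P_ ((tval t).1 + (tval u).1).
Proof. by apply: P_M; [case: t|case: u]. Qed.
Definition term_mul (t u : term) : term :=
  @Term ((tval t).1 + (tval u).1, (tval t).2 * (tval u).2)
        (term_mul_subproof t u).

Lemma term_one_subproof : (1 : {poly K}) \in P_ 0.
Proof. by rewrite !inE tofrac1 vfun1 lexx orbT. Qed.
Definition term_one : term := @Term (0, 1) term_one_subproof.

Definition fs_mul (s t : seq term) : seq term :=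
  [seq term_mul a b | a <- s, b <- t].

Lemma component_opp s alpha :
  component (map term_opp s) alpha = - component s alpha.
Proof.
rewrite /component big_map -sumrN; apply: eq_bigr => t _ /=.
by case: ifP => // _; rewrite oppr0.
Qed.

Lemma component_fs_mul s t gamma :
  component (fs_mul s t) gamma =
  \sum_(a <- s) \sum_(b <- t)
     if (tval a).1 + (tval b).1 == gamma then (tval a).2 * (tval b).2 else 0.
Proof. by rewrite /component big_allpairs_dep. Qed.

Lemma component_fs_mulr s t gamma :
  component (fs_mul s t) gamma =
  \sum_(a <- s) (tval a).2 * component t (gamma - (tval a).1).
Proof.
rewrite component_fs_mul; apply: eq_bigr => a _.
rewrite /component mulr_sumr; apply: eq_bigr => b _.
rewrite [(tval b).1 == _]eq_sym subr_eq [_ + (tval a).1]addrC eq_sym.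
by case: ifP; rewrite ?mulr0.
Qed.

Lemma fs_mulC s t : component (fs_mul s t) =1 component (fs_mul t s).
Proof.
move=> g; rewrite !component_fs_mul exchange_big; apply: eq_bigr => b _.
by apply: eq_bigr => a _; rewrite addrC mulrC.
Qed.

Definition gr_add := lift_op2 Gr (@cat term).
Definition gr_opp := lift_op1 Gr (map term_opp).
Definition gr_mul := lift_op2 Gr fs_mul.

Lemma pi_gr_add : {morph \pi : s t / s ++ t >-> gr_add s t}.
Proof.
move=> s t; unlock gr_add; apply/eqP/gr_eqP => a; rewrite !component_cat.
rewrite opprD addrACA; apply: PplusD; move: a; apply/gr_eqP;
  by rewrite reprK.
Qed.

Lemma pi_gr_opp : {morph \pi : s / map term_opp s >-> gr_opp s}.
Proof.
move=> s; unlock gr_opp; apply/eqP/gr_eqP => a; rewrite !component_opp.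
by rewrite -opprD PplusN; move: a; apply/gr_eqP; rewrite reprK.
Qed.

Lemma fs_mul_eqr s t u : \pi_Gr t = \pi_Gr u ->
  \pi_Gr (fs_mul s t) = \pi_Gr (fs_mul s u).
Proof.
move=> /eqP/gr_eqP e; apply/eqP/gr_eqP => g; rewrite !component_fs_mulr -sumrB.
elim: s => [|[a aP] s IH]; first by rewrite big_nil Pplus0.
rewrite big_cons PplusD //= -mulrBr.
by have := PplusMr aP (e (g - a.1)); rewrite [a.1 + _]addrC subrK.
Qed.

Lemma pi_gr_mul : {morph \pi : s t / fs_mul s t >-> gr_mul s t}.
Proof.
move=> s t; unlock gr_mul.
rewrite (@fs_mul_eqr s t (repr (\pi_Gr t))) ?reprK //.
rewrite (component_eq (fs_mulC _ _)) [RHS](component_eq (fs_mulC _ _)).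
by apply: fs_mul_eqr; rewrite reprK.
Qed.

Canonical pi_gr_add_morph := PiMorph2 pi_gr_add.
Canonical pi_gr_opp_morph := PiMorph1 pi_gr_opp.
Canonical pi_gr_mul_morph := PiMorph2 pi_gr_mul.

Lemma gr_addA : associative gr_add.
Proof.
by elim/quotW=> s; elim/quotW=> t; elim/quotW=> u; rewrite !piE catA.
Qed.

Lemma gr_addC : commutative gr_add.
Proof.
elim/quotW=> s; elim/quotW=> t; rewrite !piE; apply: component_eq => a.
by rewrite !component_cat addrC.
Qed.

Lemma gr_add0 : left_id (\pi_Gr [::]) gr_add.
Proof. by elim/quotW=> s; rewrite !piE. Qed.

Lemma gr_addN : left_inverse (\pi_Gr [::]) gr_opp gr_add.
Proof.
elim/quotW=> s; rewrite !piE; apply: component_eq => a.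
by rewrite component_cat component_opp addNr /component big_nil.
Qed.

HB.instance Definition _ :=
  GRing.isZmodule.Build Gr gr_addA gr_addC gr_add0 gr_addN.

Lemma gr_mulA : associative gr_mul.
Proof.
elim/quotW=> s; elim/quotW=> t; elim/quotW=> u; rewrite !piE.
apply: component_eq => g; rewrite !component_fs_mul big_allpairs_dep.
apply: eq_bigr => a _; rewrite big_allpairs_dep; apply: eq_bigr => b _.
by apply: eq_bigr => c _; rewrite addrA mulrA.
Qed.

Lemma gr_mulC : commutative gr_mul.
Proof.
elim/quotW=> s; elim/quotW=> t; rewrite !piE; apply: component_eq.
exact: fs_mulC.
Qed.

Lemma gr_mul1 : left_id (\pi_Gr [:: term_one]) gr_mul.
Proof.
elim/quotW=> s; rewrite !piE; apply: component_eq => g.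
by rewrite component_fs_mulr big_seq1 /= mul1r subr0.
Qed.

Lemma gr_mulDl : left_distributive gr_mul gr_add.
Proof.
elim/quotW=> s; elim/quotW=> t; elim/quotW=> u; rewrite !piE.
by apply: component_eq => g; rewrite component_cat !component_fs_mulr big_cat.
Qed.

Lemma gr_one_neq0 : \pi_Gr [:: term_one] != 0.
Proof.
apply/gr_eqP => /(_ 0); rewrite /component big_seq1 big_nil /= subr0.
by rewrite !inE oner_eq0 tofrac1 vfun1 ltxx.
Qed.

HB.instance Definition _ := GRing.Zmodule_isComNzRing.Build Gr
  gr_mulA gr_mulC gr_mul1 gr_mulDl gr_one_neq0.

Definition gr_unit : {pred Gr} := [pred x : Gr | `[< exists y, y * x = 1 >]].
Definition gr_inv (x : Gr) : Gr := xget x [set y | y * x = 1].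

Lemma gr_mulVx : {in gr_unit, left_inverse 1 gr_inv *%R}.
Proof. by move=> x /asboolP xU; apply: (xgetPex x xU). Qed.

Lemma gr_unitPl (x y : Gr) : y * x = 1 -> gr_unit x.
Proof. by move=> e; apply/asboolP; exists y. Qed.

Lemma gr_inv_out : {in [predC gr_unit], gr_inv =1 id}.
Proof.
move=> x /negP xU; apply: xgetPN => y e; apply: xU; exact: gr_unitPl e.
Qed.

HB.instance Definition _ := GRing.ComNzRing_hasMulInverse.Build Gr
  gr_mulVx gr_unitPl gr_inv_out.

Lemma gr_lead s : \pi_Gr s != 0 :> Gr -> exists alpha,
  component s alpha \notin Pplus alpha /\
  forall beta, alpha < beta -> component s beta \in Pplus beta.
Proof.
move=> s0; pose r := [seq a <- [seq (tval t).1 | t <- s]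
                             | component s a \notin Pplus a].
have mem_r a : component s a \notin Pplus a -> a \in r.
  move=> H; rewrite mem_filter H /=; apply: contraR H => H.
  rewrite /component big_seq big1 ?Pplus0 // => t ts; case: eqP => // e.
  by case/negP: H; rewrite -e; apply/mapP; exists t.
case: (pselect (r = [::])) => [r0|/eqP].
  case/negP: s0; apply/gr_eqP => a; rewrite [component [::] a]big_nil subr0.
  by apply: contraT => /mem_r; rewrite r0.
case er: r => [//|a r'] _.
pose m := \big[Num.max/a]_(b <- r') b.
have [mr mmax] : m \in r /\ forall b, b \in r -> b <= m.
  rewrite er /m; elim: (r') => [|b q [IH1 IH2]].
    by rewrite big_nil inE eqxx; split=> // b; rewrite inE => /eqP->.
  rewrite big_cons; split.
    rewrite !inE in IH1 *; rewrite maxEle; case: ifP => _.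
      by case/orP: IH1 => ->; rewrite ?orbT.
    by rewrite eqxx orbT.
  move=> c; rewrite !inE le_max => /or3P[] cE.
  - by rewrite IH2 ?orbT // inE cE.
  - by rewrite (eqP cE) lexx.
  - by rewrite IH2 ?orbT // inE cE orbT.
exists m; split; first by move: mr; rewrite mem_filter => /andP[].
by move=> b mb; apply: contraT => /mem_r /mmax; rewrite leNgt mb.
Qed.

Lemma val_component alpha g : g \in P_ alpha -> g \notin Pplus alpha ->
  g != 0 /\ mu g%:F = alpha.
Proof.
rewrite !inE negb_or -leNgt; have [//|g0 /= H1 H2] := eqVneq g 0.
by split=> //; apply/eqP; rewrite eq_le H1 H2.
Qed.

Lemma component_fs_mulE s t gamma :
  component (fs_mul s t) gamma =
  \sum_(a <- undup [seq (tval u).1 | u <- s])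
     component s a * component t (gamma - a).
Proof.
rewrite component_fs_mulr; under [RHS]eq_bigr => a _ do rewrite mulr_suml.
rewrite exchange_big /= [LHS]big_seq [RHS]big_seq; apply: eq_bigr => u us.
have um := map_f (fun u : term => (tval u).1) us.
rewrite (bigD1_seq (tval u).1) ?undup_uniq ?mem_undup //= eqxx.
rewrite big1 ?addr0 // => a /negPf; rewrite eq_sym => ->.
by rewrite mul0r.
Qed.

Lemma gr_integral (x y : Gr) : x * y = 0 -> (x == 0) || (y == 0).
Proof.
elim/quotW: x => s; elim/quotW: y => t st0; apply: contraT.
rewrite negb_or => /andP[/gr_lead[a [sa sM]] /gr_lead[b [tb tM]]].
have {st0}/eqP/gr_eqP/(_ (a + b)) : \pi_Gr (fs_mul s t) = \pi_Gr [::].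
  by rewrite pi_gr_mul; exact: st0.
rewrite [component [::] _]big_nil subr0 component_fs_mulE.
have au : a \in undup [seq (tval u).1 | u <- s].
  rewrite mem_undup; apply: contraR sa => H.
  rewrite /component big_seq big1 ?Pplus0 // => u us; case: eqP => // e.
  by case/negP: H; rewrite -e; apply/mapP; exists u.
rewrite (bigD1_seq a) ?undup_uniq //= [a + b]addrC addrK.
set rest := \sum_(_ <- _ | _) _ => H.
have restP : rest \in Pplus (b + a).
  rewrite /rest; elim: (undup _) => [|c q IH]; first by rewrite big_nil Pplus0.
  rewrite big_cons; case: ifP => // ca; apply: PplusD => //.
  have e : c + (b + a - c) = b + a by rewrite [c + _]addrC subrK.
  rewrite -[X in Pplus X]e.
  have [lt_ac|lt_ca|eq_ca] := ltgtP a c.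
  - by apply: PplusM; [apply: sM|apply: component_in].
  - apply: PplusMr; first exact: component_in; apply: tM.
    by rewrite -addrA ltrDl subr_gt0.
  - by rewrite eq_ca eqxx in ca.
have : component s a * component t b \in Pplus (b + a).
  by rewrite -(addrK rest (_ * _)) PplusD // PplusN.
have [s0 vs] := val_component (component_in s a) sa.
have [t0 vt] := val_component (component_in t b) tb.
rewrite !inE mulf_eq0 (negPf s0) (negPf t0) /= tofracM.
by rewrite vfunM ?tofrac_neq0 // vs vt addrC ltxx.
Qed.

HB.instance Definition _ := GRing.ComUnitRing_isIntegral.Build Gr gr_integral.

(* The class of g in P_ alpha / Pplus alpha, as a homogeneous element of
   degree alpha; it is meaningful for g in P_ alpha only. *)
Definition gr_class (alpha : rat) (g : {poly K}) : Gr :=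
  if insub (alpha, g) is Some t then \pi_Gr [:: t] else 0.

Lemma gr_class_eq alpha f g : f \in P_ alpha -> g \in P_ alpha ->
  (gr_class alpha f == gr_class alpha g) = (f - g \in Pplus alpha).
Proof.
move=> fP gP; rewrite /gr_class !insubT /=; apply/gr_eqP/idP.
  by move/(_ alpha); rewrite /component !big_seq1 /= eqxx.
move=> H b; rewrite /component !big_seq1 /=; case: eqP => [<-//|_].
by rewrite subrr Pplus0.
Qed.

(* Meaningful for g != 0. *)
Definition H_ (g : {poly K}) : Gr := gr_class (mu g%:F) g.

Definition Delta : set Gr := gr_class 0 @` [set g | g \in P_ 0].

Definition gr_dvd (a b : Gr) : Prop := exists c, b = c * a.

Definition principal_ideal (a : Gr) : {pred Gr} :=
  [pred b : Gr | `[< gr_dvd a b >]].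

Definition mu_dvd (phi g : {poly K}) : Prop := gr_dvd (H_ phi) (H_ g).

Definition mu_equiv (g h : {poly K}) : Prop := H_ g = H_ h.

Definition key_polynomial (phi : {poly K}) : Prop :=
  [/\ phi \is monic,
      H_ phi != 0,
      idealr_closed (principal_ideal (H_ phi)),
      prime_idealr_closed (principal_ideal (H_ phi)) &
      forall h : {poly K}, h != 0 -> (size h < size phi)%N -> ~ mu_dvd phi h].

Definition value_group : set rat := [set mu f | f in [set f | f != 0]].

(* The positive integer e with e Gamma(mu) = Z. *)
Definition ramification : nat :=
  xget 0%N [set e : nat |
    [set e%:R * gamma | gamma in value_group] = range (intr : int -> rat)].

End GradedAlgebra.

Arguments Delta {K} mu _.

(* The canonical map Gr(mu) -> Gr(mu'), sending the class of g in
   P_alpha(mu)/P_alpha^+(mu) to its class in P_alpha(mu')/P_alpha^+(mu').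
   It is meaningful when mu <= mu' on K[x] only; see [gr_map_class]. *)
Definition gr_map (K : fieldType) (mu mu' : valuation {fraction {poly K}} rat)
    (a : Gr mu) : Gr mu' :=
  \sum_(t <- repr a) gr_class mu' (tval t).1 (tval t).2.

Section CanonicalMap.
Variables (K : fieldType) (mu mu' : valuation {fraction {poly K}} rat).
Hypothesis le_mu : forall g : {poly K}, g != 0 -> mu g%:F <= mu' g%:F.

Lemma P_le alpha g : g \in P_ mu alpha -> g \in P_ mu' alpha.
Proof.
by rewrite !inE; case: eqVneq => //= g0 /le_trans; apply; apply: le_mu.
Qed.

Lemma Pplus_le alpha g : g \in Pplus mu alpha -> g \in Pplus mu' alpha.
Proof.
by rewrite !inE; case: eqVneq => //= g0 /lt_le_trans; apply; apply: le_mu.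
Qed.

Lemma gr_sum_pi (s : seq (term mu)) : exists s' : seq (term mu'),
  \sum_(t <- s) gr_class mu' (tval t).1 (tval t).2 = \pi_(Gr mu') s' /\
  component s' =1 component s.
Proof.
elim: s => [|[[a g] gP] s [s' [e1 e2]]].
  by exists [::]; rewrite big_nil; split=> // a; rewrite /component !big_nil.
have gP' := P_le gP; exists (Term gP' :: s').
rewrite big_cons e1 /gr_class insubT /=; split.
  have -> : \pi_(Gr mu') (Term gP' :: s') =
            \pi_(Gr mu') [:: Term gP'] + \pi_(Gr mu') s'.
    exact: (pi_gr_add [:: Term gP'] s').
  by congr (_ + _); apply: (congr1 (fun t => \pi_(Gr mu') [:: t])).
by move=> b; rewrite /component !big_cons; congr (_ + _); apply: e2.
Qed.

Lemma gr_map_pi (s : seq (term mu)) :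
  gr_map mu' (\pi_(Gr mu) s) = \sum_(t <- s) gr_class mu' (tval t).1 (tval t).2.
Proof.
rewrite /gr_map; have [s1 [-> e1]] := gr_sum_pi s.
have [s2 [-> e2]] := gr_sum_pi (repr (\pi_(Gr mu) s)).
apply/eqP/gr_eqP => a; rewrite e1 e2; apply: Pplus_le.
by move: a; apply/gr_eqP; rewrite reprK.
Qed.

Lemma gr_map_class alpha g : g \in P_ mu alpha ->
  gr_map mu' (gr_class mu alpha g) = gr_class mu' alpha g.
Proof. by move=> gP; rewrite {1}/gr_class insubT gr_map_pi big_seq1. Qed.

End CanonicalMap.

Definition is_min (S : set rat) (m : rat) : Prop :=
  S m /\ forall m', S m' -> m <= m'.

Section Augmentation.
Variable K : fieldType.
Implicit Types (mu : valuation {fraction {poly K}} rat) (phi g : {poly K}).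

Definition is_gauss (v : valuation K int) mu0 : Prop :=
  forall g, g != 0 ->
    is_min [set (v g`_s)%:~R | s in [set s : nat | g`_s != 0]] (mu0 g%:F).

(* The coefficient a_s of the phi-expansion g = sum_s a_s phi^s. *)
Definition coef_exp phi g (s : nat) : {poly K} := (g %/ phi ^+ s) %% phi.

Lemma coef_expP phi g : (1 < size phi)%N ->
  g = \sum_(s < size g) coef_exp phi g s * phi ^+ s /\
  forall s, (size (coef_exp phi g s) < size phi)%N.
Proof.
move=> phi1; have phi0 : phi != 0 by rewrite -size_poly_gt0 ltnW.
split=> [|s]; last by rewrite ltn_modp.
have E n : \sum_(s < n) coef_exp phi g s * phi ^+ s =
           g - (g %/ phi ^+ n) * phi ^+ n.
  elim: n => [|n IH]; first by rewrite big_ord0 expr0 divp1 mulr1 subrr.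
  rewrite big_ord_recr /= IH /coef_exp exprSr -divp_divl.
  set q := g %/ phi ^+ n; rewrite {1}(divp_eq q phi) mulrDl opprD addrA subrK.
  by rewrite -mulrA [phi * _]mulrC.
rewrite E divp_small ?mul0r ?subr0 //.
rewrite [ltnRHS]polySpred ?expf_neq0 // ltnS size_exp leq_pmull //.
by rewrite -ltnS prednK // ltnW.
Qed.

Definition is_augmentation mu phi (nu : rat) mu' : Prop :=
  forall g, g != 0 ->
    is_min [set mu (coef_exp phi g s * phi ^+ s)%:F + s%:R * nu
            | s in [set s : nat | coef_exp phi g s != 0]] (mu' g%:F).

Definition extends (v : valuation K int) mu : Prop :=
  forall a : K, a != 0 -> mu (a%:P)%:F = (v a)%:~R.

(* A chain of length r; the data of index > r are irrelevant. *)
Definition maclane_chain (v : valuation K int) (r : nat)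
    (mu : nat -> valuation {fraction {poly K}} rat)
    (phi : nat -> {poly K}) (nu : nat -> rat) : Prop :=
  [/\ forall i, (i <= r)%N -> extends v (mu i) /\ 0 <= mu i 'X%:F,
      is_gauss v (mu 0), phi 0 = 'X, nu 0 = 0 &
      forall i, (i < r)%N ->
        [/\ key_polynomial (mu i) (phi i.+1),
            0 < nu i.+1,
            is_augmentation (mu i) (phi i.+1) (nu i.+1) (mu i.+1) &
            (0 < i)%N -> ~ mu_dvd (mu i) (phi i.+1) (phi i)]].

End Augmentation.

Definition convex_hull (C : set (rat * rat)) : set (rat * rat) :=
  [set p | exists n (w : 'I_n -> rat) (q : 'I_n -> rat * rat),
     [/\ forall i, 0 <= w i, \sum_i w i = 1, forall i, C (q i) &
         p = (\sum_i w i * (q i).1, \sum_i w i * (q i).2)]].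

Definition lower_hull (C : set (rat * rat)) : set (rat * rat) :=
  [set p | convex_hull C p /\ forall u, convex_hull C (p.1, u) -> p.2 <= u].

(* The lines of slope -nu are the level sets of (s, u) |-> u + nu s; the first
   one touching N from below corresponds to the least value taken on N. *)
Definition slope_component (nu : rat) (N : set (rat * rat)) : set (rat * rat) :=
  [set p | N p /\ is_min [set q.2 + nu * q.1 | q in N] (p.2 + nu * p.1)].

Definition left_end (S : set (rat * rat)) (p : rat * rat) : Prop :=
  S p /\ forall q, S q -> p.1 <= q.1.

(* ord_d(q), for d monic nonconstant and q != 0; the exponent is then bounded
   by the size of q, and pseudo-divisibility by d ^+ n is divisibility. *)
Definition ord_ (A : idomainType) (d q : {poly A}) : nat :=
  [arg max_(n > ord0 : 'I_(size q).+1 | (d ^+ n %| q)%R) n].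

(* The convention mu_{-1} = mu_0 is built in: the predecessor [i.-1] of 0
   is 0. *)
Section ChainData.
Variables (K : fieldType) (mu : nat -> valuation {fraction {poly K}} rat).
Variables (phi : nat -> {poly K}) (nu : nat -> rat) (pi : K).

Definition e_ (i : nat) : nat :=
  (ramification (mu i) %/ ramification (mu i.-1))%N.

(* e(mu_i) nu_i and e(mu_{i-1}) mu_{i-1}(phi_i) are integers, hence equal to
   their numerators. *)
Definition h_ (i : nat) : int := numq ((ramification (mu i))%:R * nu i).

Definition V_ (i : nat) : int :=
  numq ((ramification (mu i.-1))%:R * mu i.-1 (phi i)%:F).

Definition bezout_ (i : nat) : int * int :=
  xget (0, 0) [set l : int * int |
    l.1 * h_ i + l.2 * (e_ i)%:Z = 1 /\ (0 <= l.1 < (e_ i)%:Z)].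

(* p_{i+1} = x_i^{l_i} p_i^{l'_i} is taken in Gr(mu_{i+1}). *)
Fixpoint p_ (i : nat) : Gr (mu i) :=
  match i return Gr (mu i) with
  | 0 => H_ (mu 0) pi%:P
  | j.+1 =>
      let x := H_ (mu j) (phi j) * p_ j ^ (- V_ j) in
      gr_map (mu j.+1) (x ^ (bezout_ j).1 * p_ j ^ (bezout_ j).2)
  end.

Definition x_ (i : nat) : Gr (mu i) := H_ (mu i) (phi i) * p_ i ^ (- V_ i).

Definition y_ (i : nat) : Gr (mu i) := x_ i ^+ e_ i * p_ i ^ (- h_ i).

(* For i >= 1. *)
Definition F_ (i : nat) : set (Gr (mu i)) :=
  [set gr_map (mu i) a | a in Delta (mu i.-1)].
Arguments F_ : clear implicits.

Definition newton_polygon (i : nat) (g : {poly K}) : set (rat * rat) :=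
  lower_hull [set (s%:R, mu i.-1 (coef_exp (phi i) g s * phi i ^+ s)%:F)
              | s in [set s : nat | coef_exp (phi i) g s != 0]].

Definition S_ (i : nat) (g : {poly K}) : set (rat * rat) :=
  slope_component (nu i) (newton_polygon i g).

Definition su_ (i : nat) (g : {poly K}) : nat * int :=
  xget (0%N, 0) [set a : nat * int |
    left_end (S_ i g) (a.1%:R, a.2%:~R / (ramification (mu i.-1))%:R)].

Definition s_ i g := (su_ i g).1.
Definition u_ i g := (su_ i g).2.

(* The elements of F_i[y] are the polynomials over Gr(mu_i) whose coefficients
   lie in F_i.  For i >= 1 and g != 0. *)
Definition R_ (i : nat) (g : {poly K}) : {poly Gr (mu i)} :=
  xget 0 [set Q : {poly Gr (mu i)} | (forall k, F_ i Q`_k) /\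
    H_ (mu i) g = x_ i ^+ s_ i g * p_ i ^ u_ i g * Q.[y_ i]].

End ChainData.

Arguments F_ {K} mu i _.

(* Main.v *)
(* Write beta for the value of phi_r under mu.  Since phi_r is a key polynomial,
   the classes H(a) of the nonzero polynomials a of degree less than deg phi_r
   form a group of homogeneous units of Gr(mu), which contains p_r, and
   phi-expansions make H(phi_r) transcendental over them in the graded sense:
   every H(g) is D(H(phi_r)) for exactly one polynomial D whose coefficient of
   degree k is 0 or the class of such an a, of value mu(g) - k beta.  Both
   S_{nu_r}(g) and R_r(g) are read off D.

   The two key polynomials have the same degree and the same value, so
   phi*_r = phi_r + a with deg a < deg phi_r and mu(a) >= beta.  If this
   inequality is strict, then H(phi*_r) = H(phi_r) and D is the same for both
   chains.  If mu(a) = beta, then beta lies in the value group of mu_{r-1}, so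
   e_r = 1, and H(g) = p_r^z y_r^s R_r(g)(y_r) with s = s_r(g) and z depending
   only on mu(g).  Comparing this with its starred version at y*_r = y_r + eta
   gives y^s R_r(g)(y) = (y + eta)^s* R*_r(g)(y + eta), and R*_r(g)(0) != 0. *)

Require Import Defs.
From mathcomp Require Import all_boot all_order all_algebra.
From mathcomp Require Import generic_quotient.
From mathcomp Require Import boolp classical_sets.
From mathcomp Require Import ring lra zify.

Set Implicit Arguments.
Unset Strict Implicit.
Unset Printing Implicit Defensive.

Import Order.TTheory GRing.Theory Num.Theory.
Local Open Scope ring_scope.
Local Open Scope quotient_scope.

(** * Homogeneous classes and initial forms in the graded algebra *)

Section GradedClasses.
Variables (K : fieldType) (mu : valuation {fraction {poly K}} rat).
Implicit Types (f g : {poly K}) (alpha beta : rat).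

Lemma mu_valM f g : f != 0 -> g != 0 -> mu (f * g)%:F = mu f%:F + mu g%:F.
Proof. by move=> f0 g0; rewrite tofracM vfunM ?tofrac_neq0. Qed.

Lemma mu_valX f n : f != 0 -> mu (f ^+ n)%:F = n%:R * mu f%:F.
Proof.
move=> f0; elim: n => [|n IH]; first by rewrite expr0 tofrac1 vfun1 mul0r.
by rewrite exprS mu_valM ?expf_neq0 // IH -natr1 mulrDl mul1r addrC.
Qed.

Lemma in_P_val g : g \in P_ mu (mu g%:F).
Proof. by rewrite !inE lexx orbT. Qed.

Lemma in_P_nz alpha g : g != 0 -> (g \in P_ mu alpha) = (alpha <= mu g%:F).
Proof. by move=> g0; rewrite !inE (negPf g0). Qed.

Lemma in_Pplus_nz alpha g :
    g != 0 -> (g \in Pplus mu alpha) = (alpha < mu g%:F).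
Proof. by move=> g0; rewrite !inE (negPf g0). Qed.

Lemma P_sum (I : finType) alpha (f : I -> {poly K}) :
  (forall i, f i \in P_ mu alpha) -> \sum_i f i \in P_ mu alpha.
Proof. by move=> fP; elim/big_ind: _ => //; [exact: P_0|exact: P_D]. Qed.

Lemma gr_classE alpha g (gP : g \in P_ mu alpha) :
  gr_class mu alpha g = \pi_(Gr mu) [:: @Term _ _ (alpha, g) gP].
Proof.
rewrite /gr_class insubT; apply: (congr1 (fun t => \pi_(Gr mu) [:: t])).
exact: val_inj.
Qed.

Lemma gr_class0 alpha : gr_class mu alpha 0 = 0.
Proof.
rewrite (gr_classE (P_0 mu alpha)); apply: component_eq => b.
by rewrite /component big_seq1 big_nil /=; case: ifP.
Qed.

Lemma gr_class_eq0 alpha f : f \in P_ mu alpha ->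
  (gr_class mu alpha f == 0) = (f \in Pplus mu alpha).
Proof. by move=> fP; rewrite -(gr_class0 alpha) gr_class_eq ?P_0 // subr0. Qed.

Lemma gr_classD alpha f g : f \in P_ mu alpha -> g \in P_ mu alpha ->
  gr_class mu alpha (f + g) = gr_class mu alpha f + gr_class mu alpha g.
Proof.
move=> fP gP; rewrite (gr_classE fP) (gr_classE gP) (gr_classE (P_D fP gP)).
rewrite -[RHS](pi_gr_add [:: @Term _ mu (alpha, f) fP]
                         [:: @Term _ mu (alpha, g) gP]).
apply: component_eq => b; rewrite /component big_seq1 big_cons big_seq1 /=.
by case: ifP; rewrite ?addr0.
Qed.

Lemma gr_classN alpha f : f \in P_ mu alpha ->
  gr_class mu alpha (- f) = - gr_class mu alpha f.
Proof.
move=> fP; apply/eqP; rewrite -addr_eq0 -gr_classD ?P_N // addNr.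
by rewrite gr_class0.
Qed.

Lemma gr_class_sum (I : finType) alpha (f : I -> {poly K}) :
  (forall i, f i \in P_ mu alpha) ->
  gr_class mu alpha (\sum_i f i) = \sum_i gr_class mu alpha (f i).
Proof.
move=> fP; pose Q a c := a \in P_ mu alpha /\ gr_class mu alpha a = c.
suff [] : Q (\sum_i f i) (\sum_i gr_class mu alpha (f i)) by [].
apply: (big_rec2 Q) => [|i a c _ [aP e]]; first by rewrite /Q P_0 gr_class0.
by rewrite /Q P_D // gr_classD // e.
Qed.

Lemma gr_classM alpha beta f g : f \in P_ mu alpha -> g \in P_ mu beta ->
  gr_class mu alpha f * gr_class mu beta g = gr_class mu (alpha + beta) (f * g).
Proof.
move=> fP gP; rewrite (gr_classE fP) (gr_classE gP) (gr_classE (P_M fP gP)).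
rewrite -[LHS](pi_gr_mul [:: @Term _ mu (alpha, f) fP]
                         [:: @Term _ mu (beta, g) gP]).
by apply: component_eq => b; rewrite /component !big_seq1.
Qed.

Lemma H_neq0 g : g != 0 -> H_ mu g != 0.
Proof.
by move=> g0; rewrite gr_class_eq0 ?in_P_val // in_Pplus_nz // ltxx.
Qed.

Lemma H_M f g : f != 0 -> g != 0 -> H_ mu (f * g) = H_ mu f * H_ mu g.
Proof. by move=> f0 g0; rewrite /H_ gr_classM ?in_P_val // mu_valM. Qed.

Lemma H_1 : H_ mu 1 = 1.
Proof.
have h1 := H_neq0 (oner_neq0 {poly K}).
by apply: (mulfI h1); rewrite -H_M ?oner_neq0 // !mulr1.
Qed.

Lemma H_X g n : g != 0 -> H_ mu (g ^+ n) = H_ mu g ^+ n.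
Proof.
move=> g0; elim: n => [|n IH]; first by rewrite H_1.
by rewrite !exprS H_M ?expf_neq0 // IH.
Qed.

Lemma gr_class_H alpha g : gr_class mu alpha g != 0 -> g \in P_ mu alpha ->
  [/\ g != 0, mu g%:F = alpha & gr_class mu alpha g = H_ mu g].
Proof.
move=> c0 gP; have [|g0 e] := val_component gP.
  by rewrite -gr_class_eq0.
by rewrite /H_ e.
Qed.

(** The graded algebra is a direct sum, so the two classes can be compared in degree [mu f]. If [g]
    had another value, [f] would have to lie strictly above its own value. *)
Lemma H_inj f g : f != 0 -> g != 0 -> H_ mu f = H_ mu g ->
  mu f%:F = mu g%:F /\ f - g \in Pplus mu (mu f%:F).
Proof.
move=> f0 g0 e; have e' : mu f%:F = mu g%:F.
  move: e; rewrite /H_ (gr_classE (in_P_val f)) (gr_classE (in_P_val g)).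
  move/eqP/gr_eqP/(_ (mu f%:F)); rewrite /component !big_seq1 /= eqxx.
  case: eqP => // _; rewrite subr0 => H; move: H.
  by rewrite in_Pplus_nz // ltxx.
split=> //; rewrite -gr_class_eq ?in_P_val //; first by apply/eqP;
  rewrite -/(H_ mu f) e /H_ e'.
by rewrite e' in_P_val.
Qed.

Lemma H_eq f g : f != 0 -> f - g \in Pplus mu (mu f%:F) ->
  [/\ g != 0, mu g%:F = mu f%:F & H_ mu f = H_ mu g].
Proof.
move=> f0 fg; have gP : g \in P_ mu (mu f%:F).
  by rewrite -[g](subKr f) P_D ?in_P_val // P_N PplusP.
have e : gr_class mu (mu f%:F) f = gr_class mu (mu f%:F) g.
  by apply/eqP; rewrite gr_class_eq ?in_P_val.
by have [|g0 vg eg] := gr_class_H _ gP; rewrite -?e ?H_neq0 // -eg.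
Qed.

Lemma P_mulr alpha f h :
  h != 0 -> (f * h \in P_ mu alpha) = (f \in P_ mu (alpha - mu h%:F)).
Proof.
move=> h0; have [->|f0] := eqVneq f 0; first by rewrite mul0r !P_0.
by rewrite !in_P_nz ?mulf_neq0 // mu_valM // lerBlDr.
Qed.

Lemma Pplus_mulr alpha f h :
  h != 0 -> (f * h \in Pplus mu alpha) = (f \in Pplus mu (alpha - mu h%:F)).
Proof.
move=> h0; have [->|f0] := eqVneq f 0; first by rewrite mul0r !Pplus0.
by rewrite !in_Pplus_nz ?mulf_neq0 // mu_valM // ltrBlDr.
Qed.

Lemma P_leq alpha beta f :
  alpha <= beta -> f \in P_ mu beta -> f \in P_ mu alpha.
Proof. by rewrite !inE => ab /orP[->//|/(le_trans ab)->]; rewrite orbT. Qed.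

Lemma Pplus_ltP alpha beta f :
  alpha < beta -> f \in P_ mu beta -> f \in Pplus mu alpha.
Proof. by rewrite !inE => ab /orP[->//|/(lt_le_trans ab)->]; rewrite orbT. Qed.

End GradedClasses.

(** * Expansions in powers of a polynomial *)

Section Expansion.
Variables (K : fieldType) (phi : {poly K}).
Hypothesis phi_gt1 : (1 < size phi)%N.
Implicit Types (q a b : {poly K}).

Lemma size_gt1_neq0 : phi != 0.
Proof. by rewrite -size_poly_gt0 ltnW. Qed.

Lemma coef_exp_rec0 q b : (size b < size phi)%N -> coef_exp phi (q * phi + b) 0
    = b.
Proof.
by move=> sb;
  rewrite /coef_exp expr0 divp1 modp_addl_mul_small // size_gt1_neq0.
Qed.

Lemma coef_exp_recS q b s : (size b < size phi)%N ->
  coef_exp phi (q * phi + b) s.+1 = coef_exp phi q s.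
Proof.
move=> sb; rewrite /coef_exp exprS -divp_divl divp_addl_mul_small //.
Qed.

Lemma coef_exp0 s : coef_exp phi 0 s = 0.
Proof. by rewrite /coef_exp div0p mod0p. Qed.

Lemma coef_exp_small a s : (size a < size phi)%N ->
  coef_exp phi a s = if s == 0%N then a else 0.
Proof.
move=> sa; have {1}-> : a = 0 * phi + a by rewrite mul0r add0r.
by case: s => [|s]; rewrite ?coef_exp_rec0 ?coef_exp_recS ?coef_exp0.
Qed.

Lemma coef_exp_self s : coef_exp phi phi s = (s == 1)%:R.
Proof.
have sz0 : (size (0%R : {poly K}) < size phi)%N by rewrite size_poly0 ltnW.
have {2}-> : phi = 1 * phi + 0 by rewrite mul1r addr0.
case: s => [|s]; rewrite ?coef_exp_rec0 ?coef_exp_recS //.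
by rewrite coef_exp_small ?size_poly1 // eqSS; case: eqP.
Qed.

(** Horner's scheme: one division by [phi] splits off the constant coefficient and shifts the
    others. *)
Lemma coef_exp_sum n (b : nat -> {poly K}) s :
  (forall k, (size (b k) < size phi)%N) -> (s < n)%N ->
  coef_exp phi (\sum_(k < n) b k * phi ^+ k) s = b s.
Proof.
elim: n b s => [|n IH] b s sb // sn.
have -> : \sum_(k < n.+1) b k * phi ^+ k =
          (\sum_(k < n) b k.+1 * phi ^+ k) * phi + b 0%N.
  rewrite big_ord_recl /= expr0 mulr1 addrC mulr_suml; congr (_ + _).
  by apply: eq_bigr => k _; rewrite exprSr mulrA.
case: s sn => [|s] sn; first by rewrite coef_exp_rec0.
by rewrite coef_exp_recS // (IH (fun k => b k.+1)).
Qed.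

End Expansion.

(** * Key polynomials and a single augmentation *)

Section AugmentationStep.
Variables (K : fieldType) (mu mu' : valuation {fraction {poly K}} rat).
Variables (phi : {poly K}) (nu : rat).
Hypothesis key : key_polynomial mu phi.
Hypothesis nu_gt0 : 0 < nu.
Hypothesis aug : is_augmentation mu phi nu mu'.
Implicit Types (f g q a b : {poly K}) (alpha : rat).

Lemma key_prime f g : f != 0 -> g != 0 ->
  mu_dvd mu phi (f * g) -> mu_dvd mu phi f \/ mu_dvd mu phi g.
Proof.
case: key => _ _ _ pr _ f0 g0; rewrite /mu_dvd H_M // => dfg.
have : H_ mu f * H_ mu g \in principal_ideal (H_ mu phi) by apply/asboolP.
by move/pr => /orP[] /asboolP; [left|right].
Qed.

(** A constant monic polynomial is 1, whose class generates the unit ideal, whereas a prime ideal is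
    proper. *)
Lemma key_gt1 : (1 < size phi)%N.
Proof.
case: key => mon H0 [_ p1 _] _ _; rewrite ltnNge; apply/negP => s1.
case/negP: p1; apply/asboolP; suff -> : phi = 1 by exists 1; rewrite H_1 mulr1.
by move: mon; rewrite (size1_polyC s1) monicE lead_coefC => /eqP->.
Qed.

Lemma key_neq0 : phi != 0. Proof. exact: size_gt1_neq0 key_gt1. Qed.

Lemma key_small b : b != 0 -> (size b < size phi)%N -> ~ mu_dvd mu phi b.
Proof. by case: key => _ _ _ _; apply. Qed.

(** If the quotient part had value below [alpha], it would cancel against the remainder, so its
    initial form would be that of [- (g %% phi)]. Then [H_ mu phi] would divide the class of a
    polynomial of degree less than that of [phi]. *)
Lemma key_modP alpha g :
  g \in P_ mu alpha -> (g %/ phi) * phi \in P_ mu alpha /\ g %% phi \in P_ mu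
    alpha.
Proof.
move=> gP; suff qP : (g %/ phi) * phi \in P_ mu alpha.
  split=> //; have -> : g %% phi = g - (g %/ phi) * phi.
    by rewrite {2}(divp_eq g phi) addrC addKr.
  by rewrite P_D ?P_N.
apply: contraT; rewrite inE negb_or -ltNge => /andP[q0 lt_q].
have [|nb0 _ eqH] := @H_eq _ mu _ (- (g %% phi)) q0.
  by rewrite opprK -divp_eq (Pplus_ltP lt_q).
have dq0 : g %/ phi != 0 by apply: contraNneq q0 => ->; rewrite mul0r.
case: (@key_small _ nb0); first by rewrite size_polyN ltn_modp key_neq0.
by exists (H_ mu (g %/ phi)); rewrite -eqH H_M // key_neq0.
Qed.

Lemma key_coefP alpha g s : g \in P_ mu alpha ->
  coef_exp phi g s \in P_ mu (alpha - s%:R * mu phi%:F).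
Proof.
move=> gP; have divP n : g %/ phi ^+ n \in P_ mu (alpha - n%:R * mu phi%:F).
  elim: n => [|n IH]; first by rewrite expr0 divp1 mul0r subr0.
  rewrite exprSr -divp_divl; have [+ _] := key_modP IH.
  rewrite P_mulr ?key_neq0 //; congr (is_true (_ \in P_ _ _)).
  by rewrite -natr1 mulrDl mul1r opprD addrA.
by have [] := key_modP (divP s).
Qed.

Let beta := mu phi%:F + nu.

Lemma coef_val g s : coef_exp phi g s != 0 ->
  mu (coef_exp phi g s * phi ^+ s)%:F + s%:R * nu =
  mu (coef_exp phi g s)%:F + s%:R * beta.
Proof.
by move=> c0;
  rewrite mu_valM ?expf_neq0 ?key_neq0 // mu_valX ?key_neq0 // -addrA -mulrDr.
Qed.

(** The minimum defining [mu'] becomes a condition on single coefficients, because a term of index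
    [s] contributes the [mu]-value of its coefficient plus [s * beta]. *)
Lemma aug_P alpha g :
  g \in P_ mu' alpha <-> forall s, coef_exp phi g s \in P_ mu (alpha - s%:R *
    beta).
Proof.
have [->|g0] := eqVneq g 0.
  by rewrite P_0; split=> // _ s; rewrite coef_exp0 P_0.
have [[s /= cs0 es] lb] := aug g0; rewrite in_P_nz //; split=> [le_g t|].
  have [->|ct0] := eqVneq (coef_exp phi g t) 0; first exact: P_0.
  rewrite in_P_nz // lerBlDr -coef_val // (le_trans le_g) //.
  by apply: lb; exists t.
by move/(_ s); rewrite in_P_nz // lerBlDr -coef_val // es.
Qed.

Lemma aug_Pplus alpha g :
  g \in Pplus mu' alpha <->
  forall s, coef_exp phi g s \in Pplus mu (alpha - s%:R * beta).
Proof.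
have [->|g0] := eqVneq g 0.
  by rewrite Pplus0; split=> // _ s; rewrite coef_exp0 Pplus0.
have [[s /= cs0 es] lb] := aug g0; rewrite in_Pplus_nz //; split=> [le_g t|].
  have [->|ct0] := eqVneq (coef_exp phi g t) 0; first exact: Pplus0.
  rewrite in_Pplus_nz // ltrBlDr -coef_val // (lt_le_trans le_g) //.
  by apply: lb; exists t.
by move/(_ s); rewrite in_Pplus_nz // ltrBlDr -coef_val // es.
Qed.

(** Each division by [phi] costs at most [mu phi], while the augmentation credits each power of
    [phi] with the larger [beta]. This inequality gives the canonical map its meaning. *)
Lemma aug_le g : g != 0 -> mu g%:F <= mu' g%:F.
Proof.
move=> g0; rewrite -in_P_nz //; apply/aug_P => s.
apply: P_leq (key_coefP s (in_P_val mu g)).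
by rewrite lerB // ler_wpM2l ?ler0n // lerDl ltW.
Qed.

Lemma aug_small_P alpha a : (size a < size phi)%N ->
  (a \in P_ mu' alpha) = (a \in P_ mu alpha).
Proof.
move=> sa; apply/idP/idP => [/aug_P/(_ 0%N)|aP].
  by rewrite coef_exp_small ?key_gt1 // mul0r subr0.
apply/aug_P => s; rewrite coef_exp_small ?key_gt1 //.
by case: eqP => [->|_]; rewrite ?P_0 // mul0r subr0.
Qed.

Lemma aug_small a : (size a < size phi)%N -> a != 0 -> mu' a%:F = mu a%:F.
Proof.
move=> sa a0; apply/eqP; rewrite eq_le aug_le // andbT -in_P_nz //.
by rewrite -aug_small_P // in_P_val.
Qed.

Lemma aug_key : mu' phi%:F = beta.
Proof.
apply/eqP; rewrite eq_le -[beta <= _]in_P_nz ?key_neq0 //; apply/andP; split.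
  have /aug_P/(_ 1%N) := in_P_val mu' phi.
  rewrite coef_exp_self ?key_gt1 // eqxx in_P_nz ?oner_eq0 // tofrac1 vfun1.
  by rewrite mul1r subr_le0.
apply/aug_P => s; rewrite coef_exp_self ?key_gt1 //.
case: eqP => [->|_]; last exact: P_0.
by rewrite in_P_nz ?oner_eq0 // tofrac1 vfun1 mul1r subrr.
Qed.

(** Terms with different powers of [phi] cannot cancel under [mu']; this is the source of the
    transcendence of the class of [phi]. *)
Lemma aug_sum_Pplus alpha n (b : nat -> {poly K}) :
  (forall k, (size (b k) < size phi)%N) ->
  \sum_(k < n) b k * phi ^+ k \in Pplus mu' alpha ->
  forall k, (k < n)%N -> b k * phi ^+ k \in Pplus mu' alpha.
Proof.
move=> sb /aug_Pplus sP k kn; rewrite Pplus_mulr ?expf_neq0 ?key_neq0 //.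
have := sP k;
  rewrite coef_exp_sum ?key_gt1 // mu_valX ?key_neq0 // aug_key => bP.
apply/aug_Pplus => s; rewrite coef_exp_small ?key_gt1 //.
by case: eqP => [->|_]; rewrite ?Pplus0 // mul0r subr0.
Qed.

Lemma aug_coefP alpha g s : g \in P_ mu' alpha ->
  coef_exp phi g s \in P_ mu' (alpha - s%:R * mu' phi%:F).
Proof.
move=> /aug_P/(_ s); rewrite aug_key aug_small_P //.
by rewrite ltn_modp key_neq0.
Qed.

(* With f = q phi + b, passing from mu to mu' raises the value of q phi by at
   least nu, so only b survives in Gr(mu'). *)
Lemma aug_not_dvd f : f != 0 -> ~ mu_dvd mu phi f ->
  [/\ f %% phi != 0, mu' f%:F = mu f%:F, mu' (f %% phi)%:F = mu f%:F &
      H_ mu' f = H_ mu' (f %% phi)].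
Proof.
move=> f0 ndf; have [qP rP] := key_modP (in_P_val mu f).
have r0 : f %% phi != 0.
  apply/eqP => r0; apply: ndf; exists (H_ mu (f %/ phi)).
  have ef : f = f %/ phi * phi by rewrite {1}(divp_eq f phi) r0 addr0.
  rewrite {1}ef H_M ?key_neq0 //.
  by apply: contraNneq f0 => q0; rewrite ef q0 mul0r.
have sr : (size (f %% phi)%R < size phi)%N by rewrite ltn_modp key_neq0.
have vr : mu (f %% phi)%:F = mu f%:F.
  apply/eqP; rewrite eq_le -[X in _ && X]in_P_nz // rP andbT leNgt;
    apply/negP => lt_r.
  have [|q0 _ eH] := @H_eq _ mu f (f %/ phi * phi) f0.
    by rewrite {1}(divp_eq f phi) addrC addKr in_Pplus_nz.
  apply: ndf; exists (H_ mu (f %/ phi)); rewrite eH H_M ?key_neq0 //.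
  by apply: contraNneq q0 => ->; rewrite mul0r.
have vr' := aug_small sr r0.
have [|_ vf eH] := @H_eq _ mu' (f %% phi) f r0.
  rewrite -opprB PplusN {1}(divp_eq f phi) addrK vr' vr.
  rewrite Pplus_mulr ?key_neq0 // aug_key.
  move: qP; rewrite P_mulr ?key_neq0 // => /(P_le aug_le); apply: Pplus_ltP.
  by rewrite /beta; move: nu_gt0; lra.
by split; rewrite // ?vf vr' vr.
Qed.

End AugmentationStep.

(** * Low-degree classes as homogeneous units, and graded expansions over them *)

Lemma coef_exp_ge_size (K : fieldType) (phi g : {poly K}) k :
  (1 < size phi)%N -> (size g <= k)%N -> coef_exp phi g k = 0.
Proof.
move=> s1 gk; rewrite /coef_exp divp_small ?mod0p //.
rewrite [ltnRHS]polySpred ?expf_neq0 ?size_gt1_neq0 // ltnS size_exp.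
by rewrite (leq_trans gk) // leq_pmull // -ltnS prednK // ltnW.
Qed.

(** The classes that serve as coefficients of homogeneous expansions; [alpha] records the degree, so
    that homogeneity can be followed through products and inverses. *)
Definition small_class (K : fieldType) (mu : valuation {fraction {poly K}} rat)
    (phi : {poly K}) (c : Gr mu) (alpha : rat) : Prop :=
  exists a : {poly K},
    [/\ a != 0, (size a < size phi)%N, mu a%:F = alpha & c = H_ mu a].

Section SmallClasses.
Variables (K : fieldType) (mu mu' : valuation {fraction {poly K}} rat).
Variables (phi : {poly K}) (nu : rat).
Hypothesis key : key_polynomial mu phi.
Hypothesis nu_gt0 : 0 < nu.
Hypothesis aug : is_augmentation mu phi nu mu'.
Implicit Types (f g q a b : {poly K}) (alpha : rat) (c d : Gr mu').

Notation small := (@small_class K mu' phi).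

Lemma small_class_neq0 c alpha : small c alpha -> c != 0.
Proof. by move=> [a [a0 _ _ ->]]; exact: H_neq0. Qed.

(** By primality [phi] does not divide [a * b] in the graded algebra of [mu], so reducing the
    product modulo [phi] leaves its class under [mu'] unchanged. *)
Lemma mul_small_mod a b : a != 0 -> b != 0 ->
  (size a < size phi)%N -> (size b < size phi)%N ->
  [/\ (a * b) %% phi != 0, mu' ((a * b) %% phi)%:F = mu' a%:F + mu' b%:F &
      H_ mu' a * H_ mu' b = H_ mu' ((a * b) %% phi)].
Proof.
move=> a0 b0 sa sb; have ab0 : a * b != 0 by rewrite mulf_neq0.
have [|r0 _ vr eH] := @aug_not_dvd _ _ _ _ _ key nu_gt0 aug _ ab0.
  by case/(key_prime key a0 b0); apply: (key_small key).
split=> //; last by rewrite -H_M.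
by rewrite vr mu_valM // !(aug_small key nu_gt0 aug).
Qed.

Lemma small_class_mul c d alpha beta :
  small c alpha -> small d beta -> small (c * d) (alpha + beta).
Proof.
move=> [a [a0 sa <- ->]] [b [b0 sb <- ->]].
have [r0 vr eH] := mul_small_mod a0 b0 sa sb.
by exists ((a * b) %% phi); split=> //; rewrite ltn_modp (key_neq0 key).
Qed.

Lemma small_class_const (k : K) : k != 0 ->
  small (H_ mu' k%:P) (mu' k%:P%:F).
Proof.
move=> k0; exists k%:P; rewrite polyC_eq0; split=> //.
by rewrite size_polyC k0 (key_gt1 key).
Qed.

(** Write [phi] as [q] times the gcd. By primality [H_ mu phi] divides the class of one factor; the
    gcd is too small in degree, so it must be [q], which then has full degree and leaves a constant
    gcd. *)
Lemma coprime_key a : a != 0 -> (size a < size phi)%N -> coprimep a phi.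
Proof.
move=> a0 sa; have phi0 := key_neq0 key.
have d0 : gcdp a phi != 0 by rewrite gcdp_eq0 negb_and a0.
have sd : (size (gcdp a phi) < size phi)%N.
  by apply: leq_ltn_trans sa; rewrite dvdp_leq // dvdp_gcdl.
have [q eq] := dvdpP _ _ (dvdp_gcdr a phi).
have q0 : q != 0 by apply: contraNneq phi0 => q0; rewrite eq q0 mul0r.
have := key_prime key q0 d0; rewrite -eq; case; first by exists 1;
  rewrite mul1r.
  move=> dq; have sq : (size phi <= size q)%N.
    by rewrite leqNgt; apply/negP => /(key_small key q0).
  have := size_mul q0 d0; rewrite -eq coprimep_def.
  move: d0 sq; rewrite -size_poly_gt0.
  by move: (size q) (size phi) (size (gcdp a phi)) => x y z; clear; lia.
by move/(key_small key d0).
Qed.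

(** A Bezout relation between [a] and [phi] makes the product of [a] with [u %% phi] congruent to a
    nonzero constant [k] modulo [phi], and the class of [k] is inverted by that of [k^-1]. *)
Lemma small_class_inv c alpha : small c alpha ->
  exists2 d, small d (- alpha) & c * d = 1.
Proof.
move=> [a [a0 sa <- ->]].
have /Bezout_coprimepP[[u w] /=] := coprime_key a0 sa.
rewrite -size_poly_eq1 => /size_poly1P[k k0 euw].
have eb : (a * (u %% phi)) %% phi = k%:P.
  rewrite modp_mul -[k%:P](@modp_small _ _ phi); last first.
    by rewrite size_polyC k0 (key_gt1 key).
  by rewrite -euw modpD modp_mull addr0 mulrC.
have b0 : u %% phi != 0.
  by apply: contraNneq k0 => b0; rewrite -polyC_eq0 -eb b0 mulr0 mod0p.
have sb : (size (u %% phi)%R < size phi)%N by rewrite ltn_modp (key_neq0 key).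
have [_ _ eH] := mul_small_mod a0 b0 sa sb; rewrite eb in eH.
have kV0 : k^-1 != 0 by rewrite invr_eq0.
have sb' : small (H_ mu' (u %% phi)) (mu' (u %% phi)%:F) by exists (u %% phi).
have [d [d0 sd vd ed]] := small_class_mul sb' (small_class_const kV0).
have e1 : H_ mu' a * H_ mu' d = 1.
  by rewrite -ed mulrA eH -H_M ?polyC_eq0 // -polyCM mulfV // H_1.
exists (H_ mu' d) => //; exists d; split=> //; apply/eqP.
rewrite -addr_eq0 addrC -mu_valM //.
have [||| -> _] := @H_inj _ mu' (a * d) 1; rewrite ?mulf_neq0 ?oner_eq0 //.
  by rewrite H_M // e1 H_1.
by rewrite tofrac1 vfun1.
Qed.

Lemma small_class_unit c alpha : small c alpha -> c \is a GRing.unit.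
Proof. by move=> /small_class_inv[d _ cd]; apply/unitrPr; exists d. Qed.

Lemma small_class1 : small 1 0.
Proof.
by have := small_class_const (oner_neq0 K); rewrite polyC1 H_1 tofrac1 vfun1.
Qed.

Lemma small_classX c alpha n : small c alpha -> small (c ^+ n) (n%:R * alpha).
Proof.
move=> sc; elim: n => [|n IH]; first by rewrite mul0r expr0;
  exact: small_class1.
by rewrite exprS -natr1 mulrDl mul1r addrC; exact: small_class_mul.
Qed.

Lemma small_class_exp c alpha (n : int) :
  small c alpha -> small (c ^ n) (n%:~R * alpha).
Proof.
move=> sc; case: n => n; first exact: small_classX.
have [d sd cd] := small_class_inv sc.
have -> : c ^ (Negz n) = d ^+ n.+1.
  rewrite -[LHS]/((c ^+ n.+1)^-1) -exprVn; congr (_ ^+ _).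
  have uc := small_class_unit sc.
  by apply: (mulrI uc); rewrite cd mulrV.
by have := small_classX n.+1 sd; rewrite NegzE mulrNz mulrN mulNr.
Qed.

Lemma residue_imageP c :
  [set gr_map mu' a | a in Delta mu]%classic c <->
  exists2 g, g \in P_ mu 0 & c = gr_class mu' 0 g.
Proof.
split=> [[_ [g gP <-] <-]|[g gP ->]].
  by exists g => //; rewrite (gr_map_class (aug_le key nu_gt0 aug)).
exists (gr_class mu 0 g); first by exists g.
by rewrite (gr_map_class (aug_le key nu_gt0 aug)).
Qed.

(** Passing to [mu'] raises the value of the quotient part by at least [nu], so in degree 0 only the
    remainder modulo [phi] survives. The residue field is thus the degree 0 part of the low-degree
    classes, together with 0. *)
Lemma residue_small c :
  [set gr_map mu' a | a in Delta mu]%classic c <-> c = 0 \/ small c 0.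
Proof.
split=> [/residue_imageP[g gP ec]|].
  have [qP rP] := key_modP key gP.
  have sr : (size (g %% phi)%R < size phi)%N by rewrite ltn_modp (key_neq0 key).
  have le_mu := aug_le key nu_gt0 aug.
  have er : c = gr_class mu' 0 (g %% phi).
    apply/eqP; rewrite ec gr_class_eq ?(P_le le_mu) // {1}(divp_eq g phi) addrK.
    rewrite Pplus_mulr ?(key_neq0 key) // (aug_key key aug).
    move: qP; rewrite P_mulr ?(key_neq0 key) // => /(P_le le_mu).
    by apply: Pplus_ltP; move: nu_gt0; lra.
  have [c0|c0] := eqVneq c 0; [by left|right].
  have [||r0 vr eH] := @gr_class_H _ mu' 0 (g %% phi); first by rewrite -er.
    exact: P_le rP.
  by exists (g %% phi); rewrite er.
case=> [->|[a [a0 sa va ->]]]; apply/residue_imageP.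
  by exists 0; rewrite ?P_0 ?gr_class0.
exists a; last by rewrite /H_ va.
by rewrite in_P_nz // -(aug_small key nu_gt0 aug) // va.
Qed.

Lemma residue_image_sub c d :
  [set gr_map mu' a | a in Delta mu]%classic c ->
  [set gr_map mu' a | a in Delta mu]%classic d ->
  [set gr_map mu' a | a in Delta mu]%classic (c - d).
Proof.
move=> /residue_imageP[f fP ->] /residue_imageP[g gP ->]; apply/residue_imageP.
have le_mu := aug_le key nu_gt0 aug.
exists (f - g); first by rewrite P_D // P_N.
by rewrite gr_classD ?gr_classN ?P_N ?(P_le le_mu).
Qed.

Lemma residue_image_mul c d :
  [set gr_map mu' a | a in Delta mu]%classic c ->
  [set gr_map mu' a | a in Delta mu]%classic d ->
  [set gr_map mu' a | a in Delta mu]%classic (c * d).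
Proof.
move=> /residue_imageP[f fP ->] /residue_imageP[g gP ->]; apply/residue_imageP.
have le_mu := aug_le key nu_gt0 aug.
exists (f * g); first by rewrite -[0]addr0 P_M.
by rewrite gr_classM ?(P_le le_mu) // addr0.
Qed.

Lemma residue_image1 : [set gr_map mu' a | a in Delta mu]%classic 1.
Proof. by apply/residue_small; right; exact: small_class1. Qed.

(** Homogeneity of degree [alpha] when the variable is given the degree of the class of [phi]. *)
Definition graded_poly (alpha : rat) (D : {poly Gr mu'}) : Prop :=
  forall k, D`_k = 0 \/ small D`_k (alpha - k%:R * mu' phi%:F).

Lemma graded_poly_coef alpha D k : graded_poly alpha D ->
  exists b, [/\ (size b < size phi)%N,
    b \in P_ mu' (alpha - k%:R * mu' phi%:F) &
    D`_k = gr_class mu' (alpha - k%:R * mu' phi%:F) b].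
Proof.
move=> /(_ k)[->|[a [a0 sa <- ->]]].
  by exists 0; rewrite size_poly0 P_0 gr_class0 ltnW // (key_gt1 key).
by exists a; rewrite in_P_val.
Qed.

Lemma graded_poly_sub alpha D E :
  graded_poly alpha D -> graded_poly alpha E -> graded_poly alpha (D - E).
Proof.
move=> gD gE k; have [b [sb bP Db]] := graded_poly_coef k gD.
have [c [sc cP Ec]] := graded_poly_coef k gE.
have bcP : b - c \in P_ mu' (alpha - k%:R * mu' phi%:F) by rewrite P_D ?P_N.
have eDE : (D - E)`_k = gr_class mu' (alpha - k%:R * mu' phi%:F) (b - c).
  by rewrite coefB Db Ec gr_classD ?gr_classN ?P_N.
have [->|nz] := eqVneq (D - E)`_k 0; [by left|right].
have [|bc0 v_bc e_bc] := gr_class_H _ bcP; first by rewrite -eDE.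
exists (b - c); split; rewrite ?eDE //.
by rewrite (leq_ltn_trans (size_polyD _ _)) // size_polyN gtn_max sb.
Qed.

Lemma H_key_exp k :
  H_ mu' phi ^+ k = gr_class mu' (k%:R * mu' phi%:F) (phi ^+ k).
Proof. by rewrite -H_X ?(key_neq0 key) // /H_ mu_valX ?(key_neq0 key). Qed.

Lemma key_exp_P k : phi ^+ k \in P_ mu' (k%:R * mu' phi%:F).
Proof. by rewrite -mu_valX ?(key_neq0 key) // in_P_val. Qed.

(** Lifting the coefficients turns the value at [H_ mu' phi] into the class of a [phi]-expansion all
    of whose terms live in degree [alpha]. If it vanishes, each term does, and the graded algebra is
    a domain. *)
Lemma graded_poly_root alpha D :
  graded_poly alpha D -> D.[H_ mu' phi] = 0 -> D = 0.
Proof.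
move=> gD; have [b bP] := choice (fun k => graded_poly_coef k gD).
have tP k : b k * phi ^+ k \in P_ mu' alpha.
  have [_ bk _] := bP k; rewrite -[alpha](subrK (k%:R * mu' phi%:F)).
  by rewrite P_M // key_exp_P.
have tE k : D`_k * H_ mu' phi ^+ k = gr_class mu' alpha (b k * phi ^+ k).
  by have [_ bk ->] := bP k; rewrite H_key_exp gr_classM ?key_exp_P // subrK.
rewrite horner_coef; under eq_bigr do rewrite tE.
rewrite -gr_class_sum // => /eqP; rewrite gr_class_eq0 ?P_sum //.
move/(aug_sum_Pplus key aug) => sP; apply/polyP => k; rewrite coef0.
have [kD|/(nth_default 0)//] := ltnP k (size D).
apply/eqP; have := tE k; rewrite (eqP (_ : gr_class _ _ _ == 0)).
  move/eqP; rewrite mulf_eq0 expf_eq0 => /orP[//|/andP[_]].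
  by rewrite (negPf (H_neq0 _ (key_neq0 key))).
by rewrite gr_class_eq0 // sP // => j; case: (bP j).
Qed.

(** The last clause identifies the support of [D] with the terms that attain the minimum defining
    [mu' g], which is what the Newton polygon sees. *)
Lemma graded_expansion g : g != 0 -> exists D,
  [/\ graded_poly (mu' g%:F) D, H_ mu' g = D.[H_ mu' phi] &
   forall k, D`_k != 0 <-> coef_exp phi g k != 0 /\
     mu (coef_exp phi g k * phi ^+ k)%:F + k%:R * nu = mu' g%:F].
Proof.
move=> g0; set alpha := mu' g%:F.
(* The class is taken in the degree prescribed by the index [k], so it vanishes exactly for the
   terms above the minimum. *)
pose c k := gr_class mu' (alpha - k%:R * mu' phi%:F) (coef_exp phi g k).
have cP k := aug_coefP key aug k (in_P_val mu' g).
have sz k : (size (coef_exp phi g k) < size phi)%N.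
  by rewrite ltn_modp (key_neq0 key).
have DE k : (\poly_(k < size g) c k)`_k = c k.
  rewrite coef_poly; case: ltnP => // gk.
  by rewrite /c coef_exp_ge_size ?(key_gt1 key) // gr_class0.
exists (\poly_(k < size g) c k); split=> [k||k]; rewrite ?DE.
- have [->|ck0] := eqVneq (c k) 0; [by left|right].
  by have [a0 va ea] := gr_class_H ck0 (cP k); exists (coef_exp phi g k).
- have [eg _] := coef_expP g (key_gt1 key).
  have -> : H_ mu' g =
      gr_class mu' alpha (\sum_(s < size g) coef_exp phi g s * phi ^+ s).
    by rewrite -eg.
  have tP k : coef_exp phi g k * phi ^+ k \in P_ mu' alpha.
    rewrite -[alpha](subrK (k%:R * mu' phi%:F)).
    exact: P_M (cP k) (key_exp_P k).
  rewrite horner_poly gr_class_sum //; apply: eq_bigr => k _.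
  by rewrite H_key_exp gr_classM ?key_exp_P ?cP // subrK.
rewrite gr_class_eq0 ?cP //; have [a0|a0] := eqVneq (coef_exp phi g k) 0.
  by rewrite a0 Pplus0; split=> // -[].
rewrite in_Pplus_nz // -leNgt (coef_val nu key a0) -(aug_key key aug).
rewrite -(aug_small key nu_gt0 aug (sz k) a0).
have := cP k; rewrite in_P_nz // -/alpha => le1.
by split=> [le2|[_ e]]; [split=> //|]; lra.
Qed.

End SmallClasses.

(** * Convex hulls, supporting lines and left end points *)

Section ConvexHulls.
Local Open Scope classical_set_scope.

Lemma convex_hull_sub (C : set (rat * rat)) p : C p -> convex_hull C p.
Proof.
move=> Cp; exists 1, (fun=> 1), (fun=> p); split=> //.
  by rewrite big_ord1.
by rewrite !big_ord1 !mul1r; case: p Cp.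
Qed.

Lemma convex_hull_subset (C D : set (rat * rat)) :
  C `<=` D -> convex_hull C `<=` convex_hull D.
Proof. by move=> CD p [n [w [q [w0 w1 Cq ->]]]]; exists n, w, q; split=> // i;
  apply: CD. Qed.

Lemma convex_comb_linear n (w : 'I_n -> rat) (q : 'I_n -> rat * rat) (a b m :
    rat) :
  \sum_i w i = 1 ->
  a * (\sum_i w i * (q i).1) + b * (\sum_i w i * (q i).2) - m =
  \sum_i w i * (a * (q i).1 + b * (q i).2 - m).
Proof.
move=> w1; rewrite -[X in _ - X]mulr1 -w1 !mulr_sumr -big_split /= -sumrB.
by apply: eq_bigr => i _; ring.
Qed.

Lemma convex_hull_ge (C : set (rat * rat)) (a b m : rat) p :
  (forall c, C c -> m <= a * c.1 + b * c.2) -> convex_hull C p ->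
  m <= a * p.1 + b * p.2.
Proof.
move=> Cm [n [w [q [w0 w1 Cq ->]]]] /=; rewrite -subr_ge0 convex_comb_linear //.
by apply: sumr_ge0 => i _; rewrite mulr_ge0 // subr_ge0 Cm.
Qed.

(** A convex combination reaches the bound [m] only if every point of nonzero weight does. *)
Lemma convex_hull_face (C : set (rat * rat)) (a b m : rat) p c0 :
  (forall c, C c -> m <= a * c.1 + b * c.2) -> convex_hull C p ->
  a * p.1 + b * p.2 = m -> C c0 -> a * c0.1 + b * c0.2 = m ->
  convex_hull [set c | C c /\ a * c.1 + b * c.2 = m] p.
Proof.
move=> Cm [n [w [q [w0 w1 Cq ->]]]] /= pm Cc0 c0m.
have tight i : w i != 0 -> a * (q i).1 + b * (q i).2 = m.
  move: pm => /eqP; rewrite -subr_eq0 convex_comb_linear // => /eqP sum0 wi0.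
  have term_ge0 j : true -> 0 <= w j * (a * (q j).1 + b * (q j).2 - m).
    by move=> _; rewrite mulr_ge0 // subr_ge0 Cm.
  have /eqP := psumr_eq0P term_ge0 sum0 (i := i) isT.
  by rewrite mulf_eq0 (negPf wi0) /= subr_eq0 => /eqP.
(* Points of weight 0 may lie off the face; they are replaced by [c0], which changes neither sum. *)
exists n, w, (fun i => if w i == 0 then c0 else q i); split=> //.
  by move=> i /=; case: eqVneq => // /tight.
by congr (_, _); apply: eq_bigr => i _; case: eqVneq => // ->; rewrite !mul0r.
Qed.

Lemma convex_hull_line (C : set (rat * rat)) (nu m : rat) p :
  (forall c, C c -> c.2 + nu * c.1 = m) -> convex_hull C p -> p.2 + nu * p.1 =
    m.
Proof.
move=> Cm Cp; apply/eqP; rewrite eq_le; apply/andP; split.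
  suff : - m <= - nu * p.1 + -1 * p.2 by lra.
  by apply: convex_hull_ge Cp => c /Cm <-; lra.
suff : m <= nu * p.1 + 1 * p.2 by lra.
by apply: convex_hull_ge Cp => c /Cm <-; lra.
Qed.


(** A hull point on the supporting line is automatically on the lower boundary, so the component is
    a face of the full hull, generated by the data points on that line. *)
Lemma slope_component_hull (C : set (rat * rat)) (nu m : rat) c0 :
  (forall c, C c -> m <= c.2 + nu * c.1) -> C c0 -> c0.2 + nu * c0.1 = m ->
  slope_component nu (lower_hull C) =
  convex_hull [set c | C c /\ c.2 + nu * c.1 = m].
Proof.
move=> Cm Cc0 c0m.
have Cm' c : C c -> m <= nu * c.1 + 1 * c.2 by rewrite mul1r addrC; exact: Cm.
have setE : [set c : rat * rat | C c /\ c.2 + nu * c.1 = m] =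
            [set c | C c /\ nu * c.1 + 1 * c.2 = m].
  by apply/funext => c; rewrite /= mul1r addrC.
have lower p : convex_hull C p -> p.2 + nu * p.1 = m -> lower_hull C p.
  move=> Cp pm; split=> // u Cu; have := convex_hull_ge Cm' Cu.
  by rewrite /= -pm; lra.
have hull_ge q : convex_hull C q -> m <= q.2 + nu * q.1.
  by move/(convex_hull_ge Cm'); rewrite mul1r addrC.
apply/seteqP; split=> p.
  move=> [[Cp _] [_ /(_ m)]] pmin; rewrite setE.
  apply: (convex_hull_face Cm') (Cp) _ (Cc0) _; last by rewrite mul1r addrC.
  apply/eqP; rewrite mul1r addrC eq_le hull_ge // andbT; apply: pmin.
  by exists c0 => //; apply: lower => //; apply: convex_hull_sub.
move=> Fp; have Cp : convex_hull C p by apply: convex_hull_subset Fp => c [].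
have pm : p.2 + nu * p.1 = m.
  by apply: convex_hull_line Fp => c [].
split; first exact: lower.
by split=> [|_ [q [Cq _] <-]]; [exists p => //;
  exact: lower|rewrite pm hull_ge].
Qed.

Lemma left_end_uniq (S : set (rat * rat)) (nu m : rat) p q :
  (forall c, S c -> c.2 + nu * c.1 = m) -> left_end S p -> left_end S q -> p =
    q.
Proof.
move=> Sm [Sp pmin] [Sq qmin].
have e1 : p.1 = q.1 by apply/eqP; rewrite eq_le pmin // qmin.
have := Sm _ Sp; rewrite -(Sm _ Sq) e1 => /addIr.
by case: p q e1 {Sp pmin Sq qmin} => [p1 p2] [q1 q2] /= -> ->.
Qed.

Lemma left_end_hull (C : set (rat * rat)) p :
  C p -> (forall q, C q -> p.1 <= q.1) -> left_end (convex_hull C) p.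
Proof.
move=> Cp pmin; split=> [|q Cq]; first exact: convex_hull_sub.
suff : p.1 <= 1 * q.1 + 0 * q.2 by rewrite mul1r mul0r addr0.
by apply: convex_hull_ge Cq => c /pmin; rewrite mul1r mul0r addr0.
Qed.

End ConvexHulls.

(** * Value groups, ramification indices and Bezout pairs *)

Lemma fraction_numden (R : idomainType) (x : {fraction R}) :
  exists n d : R, d != 0 /\ x = n%:F / d%:F.
Proof.
elim/quotW: x => x; exists \n_x, \d_x; have d0 := denom_ratioP x; split=> //.
have dF0 : (\d_x)%:F != 0 by rewrite tofrac_eq0.
apply: (mulIf dF0); rewrite mulfVK //; unlock FracField.tofrac.
rewrite -[LHS]FracField.pi_mul; apply/eqmodP => /=; rewrite FracField.equivfE.
by rewrite /FracField.mulf !numden_Ratio ?mulf_neq0 ?oner_eq0 // !mulr1 mulrC.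
Qed.

Lemma vfunV (F : fieldType) (G : realDomainType) (w : valuation F G) a :
  a != 0 -> w a^-1 = - w a.
Proof.
move=> a0; apply/eqP; rewrite -addr_eq0 -vfunM ?invr_eq0 //.
by rewrite mulVf // vfun1.
Qed.

Lemma vfunXz (F : fieldType) (G : realDomainType) (w : valuation F G) a (z :
    int) :
  a != 0 -> w (a ^ z) = w a *~ z.
Proof.
move=> a0; have natX n : w (a ^+ n) = w a *+ n.
  elim: n => [|n IH]; first by rewrite expr0 vfun1.
  by rewrite exprS vfunM ?expf_neq0 // IH mulrS.
case: z => n; first exact: natX.
by rewrite -[a ^ _]/((a ^+ n.+1)^-1) vfunV ?expf_neq0 // natX.
Qed.

Definition has_ramification (K : fieldType)
    (mu : valuation {fraction {poly K}} rat) (d : nat) : Prop :=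
  (0 < d)%N /\ forall gamma,
    value_group mu gamma <-> exists z : int, gamma = z%:~R / d%:R.

(** If [e] also scales the group onto the integers, then [e / d] is an integer, and writing 1 as [e]
    times an element of the group shows that [e] divides [d]. *)
Lemma ramificationE (K : fieldType) (mu : valuation {fraction {poly K}} rat) d :
  has_ramification mu d -> ramification mu = d.
Proof.
move=> [d0 Gd]; have dR0 : d%:R != 0 :> rat by rewrite pnatr_eq0 -lt0n.
apply: xget_unique => [/=|e /= eG].
  apply/seteqP; split=> [_ [_ /Gd[z ->] <-]|_ [z _ <-]].
    by exists z => //; rewrite mulrC divfK.
  by exists (z%:~R / d%:R); [apply/Gd; exists z|rewrite mulrC divfK].
have : [set e%:R * gamma | gamma in value_group mu]%classic (e%:R / d%:R).
  by exists d%:R^-1 => //; apply/Gd; exists 1; rewrite mul1r.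
rewrite eG => -[z _ ez].
have : range (intr : int -> rat) 1 by exists 1.
rewrite -eG => -[_ /Gd[z' ->] ez'].
have e1 : e%:Z = z * d%:Z.
  by apply/eqP; rewrite -(eqr_int rat) intrM; apply/eqP; rewrite ez divfK.
have e2 : d%:Z = z' * e%:Z.
  apply/eqP; rewrite -(eqr_int rat) intrM; apply/eqP.
  transitivity (d%:R * (e%:R * (z'%:~R / d%:R)) : rat);
    first by rewrite ez' mulr1.
  by rewrite -[e%:Z%:~R]/(e%:R : rat); field.
have d1 : (d%:Z %| e%:Z)%Z by rewrite e1 dvdz_mull.
have d2 : (e%:Z %| d%:Z)%Z by rewrite e2 dvdz_mull.
by apply/eqP; rewrite eqn_dvd; apply/andP.
Qed.

(** The new value group is generated by [1 / d] and [nu]. Since [d * nu] has reduced denominator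
    [e], this is the group generated by [1 / (e * d)]. *)
Lemma has_ramification_aug (K : fieldType)
    (mu mu' : valuation {fraction {poly K}} rat) phi nu d :
  key_polynomial mu phi -> 0 < nu -> is_augmentation mu phi nu mu' ->
  has_ramification mu d ->
  (forall z : int, exists2 a : {poly K}, a != 0 & mu' a%:F = z%:~R / d%:R) ->
  has_ramification mu' (`|denq (d%:R * nu)| * d)%N.
Proof.
move=> key nu_gt0 aug [d0 Gd] smallv; have phi0 := key_neq0 key.
have dR0 : d%:R != 0 :> rat by rewrite pnatr_eq0 -lt0n.
set e := `|_|%N; set h := numq (d%:R * nu).
have eE : (e%:R : rat) = (denq (d%:R * nu))%:~R.
  by rewrite -[e%:R]/((e%:Z)%:~R) absz_denq.
have eR0 : e%:R != 0 :> rat by rewrite eE intr_eq0 denq_neq0.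
have nuE : nu = h%:~R / (e%:R * d%:R).
  by rewrite /h numqE -eE; field; rewrite eR0 dR0.
have [zphi vphi] : exists z : int, mu phi%:F = z%:~R / d%:R.
  by apply/Gd; exists phi%:F => //=; rewrite tofrac_eq0.
have polyv g : g != 0 -> exists z : int, mu' g%:F = z%:~R / (e%:R * d%:R).
  move=> g0; have [[s cs0 <-] _] := aug g g0.
  have [z ->] : exists z : int, mu (coef_exp phi g s * phi ^+ s)%:F = z%:~R /
    d%:R.
    by apply/Gd; eexists; last reflexivity;
      rewrite /= tofrac_eq0 mulf_neq0 ?expf_neq0.
  exists (z * e%:Z + s%:Z * h); rewrite nuE intrD !intrM -!pmulrn.
  by field; rewrite eR0 dR0.
split; first by rewrite muln_gt0 d0 andbT absz_gt0 denq_neq0.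
move=> gamma; rewrite natrM; split=> [[x /= x0 <-]|[z ->]].
  have [n [m [m0 xE]]] := fraction_numden x.
  have n0 : n != 0.
    by apply: contraNneq x0 => n0; rewrite xE n0 tofrac0 mul0r.
  have [zn en] := polyv _ n0; have [zm em] := polyv _ m0.
  exists (zn - zm); rewrite xE vfunM ?invr_eq0 ?tofrac_eq0 //.
  by rewrite vfunV ?tofrac_eq0 // en em intrB mulrBl.
have [u [w]] := Bezoutz h e%:Z.
have -> : gcdz h e%:Z = 1.
  by apply/eqP; rewrite -[_ == _]/(coprimez h e%:Z) coprimezE coprime_num_den.
(* The power [phi ^ (z * u)] has value [z * u * (zphi / d + h / (e * d))]; the value of [a] removes
   the part with [zphi] and adds [z * w / d], leaving [z * (u * h + w * e) / (e * d)]. *)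
move=> uw; have [a a0 va] := smallv (z * w - z * u * zphi).
exists (phi%:F ^ (z * u) * a%:F) => /=.
  by rewrite mulf_neq0 ?expfz_neq0 ?tofrac_eq0.
rewrite vfunM ?expfz_neq0 ?tofrac_eq0 // vfunXz ?tofrac_eq0 // -mulrzl va.
rewrite (aug_key key aug) vphi nuE intrB !intrM.
have : u%:~R * h%:~R + w%:~R * e%:R = 1 :> rat.
  by rewrite -[e%:R]/((e%:Z)%:~R) -!intrM -intrD uw.
move=> uw'; apply: (mulIf (mulf_neq0 eR0 dR0)); rewrite divfK ?mulf_neq0 //.
transitivity (z%:~R * (u%:~R * h%:~R + w%:~R * e%:R) : rat).
  by field; rewrite eR0 dR0.
by rewrite uw' mulr1.
Qed.

Lemma bezout_spec (K : fieldType) (mu : nat -> valuation {fraction {poly K}}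
    rat)
    nu i :
  coprimez (h_ mu nu i) (e_ mu i)%:Z -> (0 < e_ mu i)%N ->
  (bezout_ mu nu i).1 * h_ mu nu i + (bezout_ mu nu i).2 * (e_ mu i)%:Z = 1 /\
  0 <= (bezout_ mu nu i).1 < (e_ mu i)%:Z.
Proof.
set h := h_ _ _ _; set e := e_ _ _ => cop e0.
apply: (@xgetPex _ (0, 0) [set l : int * int |
  l.1 * h + l.2 * e%:Z = 1 /\ 0 <= l.1 < e%:Z]%classic).
have [u [w]] := Bezoutz h e%:Z; rewrite (eqP (cop : gcdz _ _ == 1)) => uw.
have eZ : e%:Z != 0 by lia.
(* Reducing [u] modulo [e] meets the range condition; the quotient times [h] is moved to the other
   coefficient. *)
exists ((u %% e%:Z)%Z, w + (u %/ e%:Z)%Z * h) => /=; split.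
  by rewrite -uw [in RHS](divz_eq u e%:Z); ring.
by rewrite modz_ge0 // ltz_mod.
Qed.

(** An element of value 1 is a product of [pi], of value at least 1, with an element of nonnegative
    value. *)
Lemma generator_val (K : fieldType) (v : valuation K int) pi :
  (forall z : int, exists2 a : K, a != 0 & v a = z) ->
  generates_maximal_ideal v pi -> pi != 0 /\ v pi = 1.
Proof.
move=> surj gen; have [a a0 va] := surj 1.
have [b bring ab] : exists2 b, in_valuation_ring v b & a = b * pi.
  by apply/gen; right; rewrite va.
have /andP[b0 pi0] : (b != 0) && (pi != 0) by rewrite -negb_or -mulf_eq0 -ab.
have : in_maximal_ideal v pi.
  by apply/gen; exists 1; rewrite ?mul1r //; right; rewrite vfun1.
case=> [/eqP|vpi]; first by rewrite (negPf pi0).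
case: bring => [/eqP|vb]; first by rewrite (negPf b0).
by split=> //; move: va; rewrite ab vfunM //; lia.
Qed.

(** * Induction along a MacLane chain *)

Section Chain.
Variables (K : fieldType) (v : valuation K int) (pi : K).
Hypothesis v_surj : forall z : int, exists2 a : K, a != 0 & v a = z.
Hypothesis pi_gen : generates_maximal_ideal v pi.
Variables (r : nat) (mu : nat -> valuation {fraction {poly K}} rat).
Variables (phi : nat -> {poly K}) (nu : nat -> rat).
Hypothesis chain : maclane_chain v r mu phi nu.

Notation p := (p_ mu phi nu pi).
Notation ram i := (ramification (mu i)).

(** The invariant of the induction: the numerators in [h_] and [V_] compute the true values, and
    every power of [p] is a low-degree class of the expected degree. *)
Record chain_data (i : nat) : Prop := ChainData {
  cd_pred : has_ramification (mu i.-1) (ram i.-1);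
  cd_ram : has_ramification (mu i) (ram i);
  cd_e : ram i = (e_ mu i * ram i.-1)%N;
  cd_h : (ram i)%:R * nu i = (h_ mu nu i)%:~R;
  cd_coprime : coprimez (h_ mu nu i) (e_ mu i)%:Z;
  cd_V : mu i (phi i)%:F = (V_ mu phi i)%:~R / (ram i.-1)%:R + nu i;
  cd_p : forall z : int, small_class (phi i) (p i ^ z) (z%:~R / (ram i.-1)%:R);
  cd_unit : p i \is a GRing.unit }.

Lemma gauss_ramification : has_ramification (mu 0) 1.
Proof.
have [ext gauss _ _ _] := chain; have [ext0 _] := ext 0 (leq0n r).
have polyv g : g != 0 -> exists z : int, mu 0 g%:F = z%:~R.
  by move=> /gauss[[s _ <-] _]; eexists.
split=> // gamma; split=> [[x /= x0 <-]|[z ->]].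
  have [n [m [m0 xE]]] := fraction_numden x.
  have n0 : n != 0.
    by apply: contraNneq x0 => n0; rewrite xE n0 tofrac0 mul0r.
  have [zn en] := polyv _ n0; have [zm em] := polyv _ m0.
  exists (zn - zm); rewrite xE vfunM ?invr_eq0 ?tofrac_eq0 //.
  by rewrite vfunV ?tofrac_eq0 // en em intrB divr1.
have [a a0 va] := v_surj z; exists a%:P%:F;
  first by rewrite /= tofrac_eq0 polyC_eq0.
by rewrite ext0 // va divr1.
Qed.

Lemma chain_data0 : chain_data 0.
Proof.
have [ext gauss phi0 nu0 _] := chain; have [ext0 _] := ext 0 (leq0n r).
have ram0 := ramificationE gauss_ramification.
have [pi0 vpi] := generator_val v_surj pi_gen.
have e0 : e_ mu 0 = 1 by rewrite /e_ /= ram0.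
have h0 : h_ mu nu 0 = 0 by rewrite /h_ nu0 mulr0.
have muX : mu 0 'X%:F = 0.
  have [|[s /= cs <-] _] := gauss 'X; first by rewrite polyX_eq0.
  by move: cs => /=; rewrite coefX; case: (s == 1)%N; rewrite ?eqxx ?vfun1.
have HpiV : H_ (mu 0) pi%:P * H_ (mu 0) pi^-1%:P = 1.
  by rewrite -H_M ?polyC_eq0 ?invr_eq0 // -polyCM mulfV // H_1.
have upi : H_ (mu 0) pi%:P \is a GRing.unit by apply/unitrPr; eexists;
  exact: HpiV.
have pX (z : int) : p 0 ^ z = H_ (mu 0) (pi ^ z)%:P.
  case: z => n;
    first by rewrite -[_ ^ _ in RHS]/(pi ^+ n) polyC_exp H_X ?polyC_eq0.
  rewrite -[LHS]/((H_ (mu 0) pi%:P ^+ n.+1)^-1) -exprVn.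
  rewrite -[_ ^ _ in RHS]/((pi ^+ n.+1)^-1) -exprVn polyC_exp.
  rewrite H_X ?polyC_eq0 ?invr_eq0 //; congr (_ ^+ _).
  by apply: (mulrI upi); rewrite HpiV mulrV.
split; rewrite /= ?ram0 ?e0 ?h0 ?nu0 ?phi0 ?mulr0 //.
- exact: gauss_ramification.
- exact: gauss_ramification.
- by rewrite /V_ /= phi0 muX mulr0 mul0r addr0.
move=> z; exists (pi ^ z)%:P; split;
  rewrite ?polyC_eq0 ?expfz_neq0 ?size_polyX //.
  by rewrite size_polyC; case: eqP.
by rewrite ext0 ?expfz_neq0 // vfunXz // vpi divr1 intz.
Qed.

Lemma not_dvd_unit i f g : key_polynomial (mu i) f ->
  H_ (mu i) g \is a GRing.unit -> ~ mu_dvd (mu i) f g.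
Proof.
case=> _ _ [_ /negP n1 _] _ _ ug [c gE]; apply: n1; apply/asboolP.
by exists ((H_ (mu i) g)^-1 * c); rewrite -mulrA -gE mulVr.
Qed.

(** For positive [i], primality reduces the claim to [phi i] itself, where it is an axiom of chains.
    For [i = 0] the index [e_ mu 0] is 1, so only the unit class with [n = 0] occurs. *)
Lemma not_dvd_chain_exp i n : (i < r)%N -> phi i != 0 -> (n%:Z < (e_ mu i)%:Z)
    ->
  ~ mu_dvd (mu i) (phi i.+1) (phi i ^+ n).
Proof.
have [_ _ _ _ steps] := chain; move=> ir phii0 ne.
have [key _ _ nd] := steps i ir.
elim: n ne => [|n IH] ne; first by apply: (not_dvd_unit key);
  rewrite expr0 H_1 unitr1.
rewrite exprS => /(key_prime key phii0 (expf_neq0 _ phii0))[];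
  last by apply: IH; lia.
have [i0|] := posnP i; last exact: nd.
have := ramificationE gauss_ramification.
by rewrite i0 /e_ /= => e1; move: ne; rewrite i0 /e_ /= e1.
Qed.

(** The new [p] is the image of the class of [f], a power of [phi i] times a low-degree polynomial.
    The next key polynomial does not divide it, so the image is the class of a remainder, of value
    [1 / ram i] by the Bezout identity. Its powers attain all values needed for the next
    ramification index. *)
Lemma chain_dataS i : (i < r)%N -> chain_data i -> chain_data i.+1.
Proof.
move=> ir [pr rm eE hE cop VE pE pU]; have [_ _ _ _ steps] := chain.
have [key nu_gt0 aug nd] := steps i ir.
have phii0 : phi i != 0.
  case: i {pr rm eE hE cop VE pE pU key nu_gt0 aug nd} ir => [|j] jr.
    by have [_ _ -> _ _] := chain; rewrite polyX_eq0.
  by have [key _ _ _] := steps j (ltnW jr); exact: key_neq0 key.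
have d'0 : (0 < ram i.-1)%N by case: pr.
have d0 : (0 < ram i)%N by case: rm.
have e0 : (0 < e_ mu i)%N by move: d0; rewrite eE muln_gt0 => /andP[].
have dR : (ram i)%:R != 0 :> rat by rewrite pnatr_eq0 -lt0n.
have d'R : (ram i.-1)%:R != 0 :> rat by rewrite pnatr_eq0 -lt0n.
have eR : (e_ mu i)%:R != 0 :> rat by rewrite pnatr_eq0 -lt0n.
have dRE : (ram i)%:R = (e_ mu i)%:R * (ram i.-1)%:R :> rat by rewrite eE natrM.
have [] := bezout_spec cop e0; case eb : (bezout_ mu nu i) => [l1 l2] /= lE.
(* The range condition on the Bezout pair makes its first entry a natural number [n] below [e],
   within reach of [not_dvd_chain_exp]. *)
move=> /andP[]; case: l1 eb lE => // n eb lE _ ne.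
set V := V_ mu phi i in VE.
(* Since [x_ i] carries the factor [p ^ (- V)], the product of [x ^ n] and [p ^ l2] is
   [H_ (phi i) ^ n] times the power of [p] represented by [a]. *)
have [a [a0 sa va Ha]] := pE (l2 - V * n%:Z).
pose f := phi i ^+ n * a.
have f0 : f != 0 by rewrite mulf_neq0 ?expf_neq0.
have ndf : ~ mu_dvd (mu i) (phi i.+1) f.
  move/(key_prime key (expf_neq0 _ phii0) a0) => [];
    first exact: not_dvd_chain_exp.
  by apply: (not_dvd_unit key); rewrite -Ha unitrXz.
have vf : mu i f%:F = 1 / (ram i)%:R.
  rewrite mu_valM ?expf_neq0 // mu_valX // va VE dRE.
  have -> : nu i = (h_ mu nu i)%:~R / ((e_ mu i)%:R * (ram i.-1)%:R).
    by rewrite -hE dRE mulrC mulKf // mulf_neq0.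
  have lE' : n%:R * (h_ mu nu i)%:~R + l2%:~R * (e_ mu i)%:R = 1 :> rat.
    by have := congr1 (intr : int -> rat) lE; rewrite intrD !intrM.
  transitivity ((n%:R * (h_ mu nu i)%:~R + l2%:~R * (e_ mu i)%:R) /
    ((e_ mu i)%:R * (ram i.-1)%:R) : rat); last by rewrite lE'.
  by rewrite intrB intrM -pmulrn; field; rewrite eR d'R.
have pS : p i.+1 = H_ (mu i.+1) (f %% phi i.+1).
  have [_ vf' _ <-] := aug_not_dvd key nu_gt0 aug f0 ndf.
  rewrite /= eb /= -[_ ^ n%:Z]/(_ ^+ n) exprMn -mulrA.
  rewrite [(p i ^ _) ^+ n]exprnP exprz_exp -exprzDr // -/V [_ + l2]addrC mulNr
    Ha.
  rewrite -H_X // -H_M ?expf_neq0 // -/f.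
  by rewrite (gr_map_class (aug_le key nu_gt0 aug)) ?in_P_val // /H_ vf'.
have smp : small_class (phi i.+1) (p i.+1) (1 / (ram i)%:R).
  have [r0 _ vr _] := aug_not_dvd key nu_gt0 aug f0 ndf.
  by exists (f %% phi i.+1); rewrite pS vr vf ltn_modp (key_neq0 key).
have smX (z : int) : small_class (phi i.+1) (p i.+1 ^ z) (z%:~R / (ram i)%:R).
  by have := small_class_exp key nu_gt0 aug z smp; rewrite div1r.
have rmS : has_ramification (mu i.+1) (`|denq ((ram i)%:R * nu i.+1)| * ram i).
  apply: (has_ramification_aug key nu_gt0 aug rm) => z.
  by have [b [b0 _ vb _]] := smX z; exists b.
have ramE := ramificationE rmS.
have eSE : e_ mu i.+1 = `|denq ((ram i)%:R * nu i.+1)|%N by rewrite /e_ /= ramE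
  mulnK.
have hS : (ram i.+1)%:R * nu i.+1 = (numq ((ram i)%:R * nu i.+1))%:~R.
  rewrite ramE natrM -mulrA numqE mulrC; congr (_ * _).
  by rewrite pmulrn absz_denq.
have hSE : h_ mu nu i.+1 = numq ((ram i)%:R * nu i.+1).
  by rewrite /h_ hS numq_int.
have [_ Gd] := rm.
have [z vphi] : exists z : int, mu i (phi i.+1)%:F = z%:~R / (ram i)%:R.
  by apply/Gd; exists (phi i.+1)%:F => //=; rewrite tofrac_eq0 (key_neq0 key).
split=> //.
- by rewrite ramE.
- by rewrite eSE ramE.
- by rewrite hSE hS.
- by rewrite hSE eSE coprimezE absz_id coprime_num_den.
- rewrite (aug_key key aug); congr (_ + _); rewrite vphi /V_ /= vphi.
  by rewrite [_%:R * _]mulrC divfK // numq_int.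
exact: small_class_unit key nu_gt0 aug _ _ smp.
Qed.

Lemma chain_dataP i : (i <= r)%N -> chain_data i.
Proof.
elim: i => [|i IH] ir; first exact: chain_data0.
by apply: chain_dataS => //; apply: IH; apply: ltnW.
Qed.

End Chain.

(** * Multiplicities of roots and shifted polynomials *)

Section OrderAtRoot.
Variable A : idomainType.
Implicit Types (p q : {poly A}) (a : A).

Lemma ord_XsubC q a m : ~~ root q a -> ord_ ('X - a%:P) (q * ('X - a%:P) ^+ m)
    = m.
Proof.
move=> qa; have dmon n : ('X - a%:P) ^+ n \is monic by rewrite monic_exp
  ?monicXsubC.
have d0 n : ('X - a%:P) ^+ n != 0 by rewrite monic_neq0.
have q0 : q != 0 by apply: contraNneq qa => ->; rewrite root0.
rewrite /ord_; set p := q * _.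
(* The maximum in [ord_] runs over a bounded range, which has to contain [m]. *)
have m_lt : (m < (size p).+1)%N.
  by rewrite ltnS /p size_mul // size_exp_XsubC addnS leq_addl.
case: arg_maxnP => [|i /= di imax]; first by rewrite expr0 dvd1p.
apply/eqP; rewrite eqn_leq (imax (Ordinal m_lt)) ?andbT /=;
  last exact: dvdp_mull.
rewrite leqNgt; apply/negP => mi.
have [t et] := Pdiv.IdomainMonic.dvdpP (dmon _) _ di.
case/negP: qa; suff -> : q = t * ('X - a%:P) ^+ (i - m).
  by rewrite rootM /root horner_exp hornerXsubC subrr expr0n subn_eq0 leqNgt mi
    eqxx orbT.
by apply: (mulIf (d0 m)); rewrite -mulrA -exprD subnK ?(ltnW mi) //; exact: et.
Qed.

Lemma root_factor_uniq p q a m n : ~~ root p a -> ~~ root q a ->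
  p * ('X - a%:P) ^+ m = q * ('X - a%:P) ^+ n -> p = q /\ m = n.
Proof.
move=> pa qa e; have mn : m = n by rewrite -(ord_XsubC m pa) e ord_XsubC.
by split=> //; move: e; rewrite mn; apply: mulIf;
  rewrite expf_neq0 ?polyXsubC_eq0.
Qed.

(* Comparing the multiplicities of the root [- eta] on both sides of
   X^s R(X) = (X + eta)^s' R'(X + eta). *)
Lemma shifted_residual (R R' : {poly A}) (eta : A) (s s' : nat) :
  eta != 0 -> R != 0 -> R'`_0 != 0 ->
  'X^s * R = ('X^s' * R') \Po ('X + eta%:P) ->
  s' = ord_ ('X + eta%:P) R /\
  R' = ('X - eta%:P) ^+ s * ((R %/ ('X + eta%:P) ^+ s') \Po ('X - eta%:P)).
Proof.
move=> eta0 R0 R'0 e.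
have dE : 'X + eta%:P = 'X - (- eta)%:P by rewrite polyCN opprK.
have [m [q]] := multiplicity_XsubC R (- eta); rewrite R0 /= -dE => qa RE.
have Xqa : ~~ root ('X^s * q) (- eta).
  by rewrite rootM negb_or qa andbT /root hornerXn expf_eq0 oppr_eq0 (negPf
    eta0) andbF.
have R'a : ~~ root (R' \Po ('X + eta%:P)) (- eta).
  by rewrite /root horner_comp !hornerE addNr horner_coef0.
have [] := @root_factor_uniq ('X^s * q) (R' \Po ('X + eta%:P)) (- eta) m s' Xqa
  R'a.
  by rewrite -dE -mulrA -RE e comp_polyM comp_Xn_poly mulrC.
move=> Xq ms; rewrite RE -ms dE ord_XsubC //; split=> //.
rewrite Pdiv.IdomainMonic.mulpK ?monic_exp ?monicXsubC //.
rewrite -[LHS](comp_polyXaddC_K _ eta) -Xq comp_polyM comp_Xn_poly.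
by [].
Qed.

End OrderAtRoot.

(** * Newton component and residual polynomial at the last step *)

Section FinalStep.
Variables (K : fieldType) (pi : K) (i : nat).
Variables (mu : nat -> valuation {fraction {poly K}} rat).
Variables (phi : nat -> {poly K}) (nu : nat -> rat).
Hypothesis key : key_polynomial (mu i) (phi i.+1).
Hypothesis nu_gt0 : 0 < nu i.+1.
Hypothesis aug : is_augmentation (mu i) (phi i.+1) (nu i.+1) (mu i.+1).
Hypothesis data : chain_data pi mu phi nu i.+1.

Notation F := (F_ mu i.+1).
Notation d := (ramification (mu i)).
Notation e := (e_ mu i.+1).
Notation h := (h_ mu nu i.+1).
Notation V := (V_ mu phi i.+1).
Notation p := (p_ mu phi nu pi i.+1).
Notation x := (x_ mu phi nu pi i.+1).
Notation y := (y_ mu phi nu pi i.+1).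
Notation Hphi := (H_ (mu i.+1) (phi i.+1)).
Notation beta := (mu i.+1 (phi i.+1)%:F).
Implicit Types (g : {poly K}) (Q R D : {poly Gr (mu i.+1)}).

Lemma step_ram_gt0 : (0 < d)%N. Proof. by case: (cd_pred data). Qed.

Lemma step_ram_neq0 : d%:R != 0 :> rat.
Proof. by rewrite pnatr_eq0 -lt0n step_ram_gt0. Qed.

Lemma step_e_gt0 : (0 < e)%N.
Proof. by case: (cd_ram data); rewrite (cd_e data) muln_gt0 => /andP[]. Qed.

Lemma step_nu : nu i.+1 = h%:~R / (e%:R * d%:R).
Proof.
have eR : e%:R != 0 :> rat by rewrite pnatr_eq0 -lt0n step_e_gt0.
rewrite -(cd_h data) (cd_e data) natrM /=.
by rewrite mulrC mulKf // mulf_neq0 ?step_ram_neq0.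
Qed.

Lemma step_key_val : e%:R * beta = (V * e%:Z + h)%:~R / d%:R.
Proof.
have eR : e%:R != 0 :> rat by rewrite pnatr_eq0 -lt0n step_e_gt0.
rewrite (cd_V data) step_nu /= intrD intrM -pmulrn.
by field; rewrite step_ram_neq0 eR.
Qed.

Lemma Hphi_x : Hphi = x * p ^ V.
Proof. by rewrite /x_ -mulrA -exprzDr ?(cd_unit data) // addNr expr0z mulr1.
  Qed.

Lemma x_neq0 : x != 0.
Proof.
by apply: contraNneq (H_neq0 (mu i.+1) (key_neq0 key)) => x0;
  rewrite Hphi_x x0 mul0r.
Qed.

Lemma y_key : y = Hphi ^+ e * p ^ (- (V * e%:Z + h)).
Proof.
rewrite Hphi_x exprMn [(p ^ V) ^+ _]exprnP exprz_exp -mulrA.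
rewrite -exprzDr ?(cd_unit data) //; congr (_ * p ^ _).
by lia.
Qed.

Lemma residueP c : F c <-> c = 0 \/ small_class (phi i.+1) c 0.
Proof. exact: (residue_small key nu_gt0 aug). Qed.

(** By [y_key], [y] is [Hphi ^ e] times a power of [p]. Absorbing that power into the coefficients
    turns [Q] into a polynomial in the e-th power of the variable, homogeneous of degree 0, to which
    [graded_poly_root] applies. *)
Lemma y_transcendental Q : (forall k, F Q`_k) -> Q.[y] = 0 -> Q = 0.
Proof.
move=> FQ Qy; set m := V * e%:Z + h.
pose Q1 := \poly_(k < size Q) (Q`_k * (p ^ (- m)) ^+ k).
have Q1E k : Q1`_k = Q`_k * (p ^ (- m)) ^+ k.
  by rewrite coef_poly; case: ltnP => // /(nth_default 0)->; rewrite mul0r.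
have wE := small_classX key nu_gt0 aug _ (cd_p data (- m)).
have gQ : graded_poly (phi i.+1) 0 (Q1 \Po 'X^e).
  move=> k; rewrite coef_comp_poly_Xn ?step_e_gt0 //.
  case: ifP => [/dvdnP[t ->]|_]; last by left.
  rewrite mulnK ?step_e_gt0 // Q1E.
  have [->|sQ] := (residueP _).1 (FQ t); first by left; rewrite mul0r.
  right; have := small_class_mul key nu_gt0 aug sQ (wE t).
  by rewrite natrM sub0r -mulrA step_key_val -/m intrN add0r mulNr mulrN.
have Q10 : Q1 \Po 'X^e = 0.
  apply: (graded_poly_root key aug gQ);
    rewrite horner_comp hornerXn horner_poly.
  rewrite -[RHS]Qy [RHS]horner_coef; apply: eq_bigr => k _.
  by rewrite y_key -/m [in RHS]exprMn -mulrA; congr (_ * _); rewrite mulrC.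
apply/polyP => k; rewrite coef0; apply/eqP.
have := congr1 (fun P : {poly _} => P`_(k * e)) Q10.
rewrite coef_comp_poly_Xn ?step_e_gt0 // dvdn_mull // mulnK ?step_e_gt0 // Q1E
  coef0.
move/eqP; rewrite mulf_eq0 => /orP[//|/eqP w0].
by move: (small_class_neq0 (wE k)); rewrite w0 eqxx.
Qed.

Lemma residue_sub a b : F a -> F b -> F (a - b).
Proof. exact: (residue_image_sub key nu_gt0 aug). Qed.

Lemma residue_mul a b : F a -> F b -> F (a * b).
Proof. exact: (residue_image_mul key nu_gt0 aug). Qed.

Lemma residue1 : F 1.
Proof. exact: (residue_image1 key nu_gt0 aug). Qed.

Lemma residue0 : F 0.
Proof. by apply/residueP; left. Qed.

Lemma residue_add a b : F a -> F b -> F (a + b).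
Proof.
by move=> Fa Fb; rewrite -[b]opprK -[- b]sub0r; do 2?apply: residue_sub => //;
  exact: residue0.
Qed.

Lemma residue_poly_add Q R : (forall k, F Q`_k) -> (forall k, F R`_k) ->
  forall k, F (Q + R)`_k.
Proof. by move=> FQ FR k; rewrite coefD; apply: residue_add. Qed.

Lemma residue_poly_mul Q R : (forall k, F Q`_k) -> (forall k, F R`_k) ->
  forall k, F (Q * R)`_k.
Proof.
move=> FQ FR k; rewrite coefM; elim/big_ind: _ => [||j _];
  first exact: residue0.
  exact: residue_add.
exact: residue_mul.
Qed.

Lemma residue_poly_const a : F a -> forall k, F (a%:P)`_k.
Proof. by move=> Fa k; rewrite coefC; case: eqP => // _; exact: residue0. Qed.

Lemma residue_polyXn n k : F ('X^n)`_k.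
Proof. by rewrite coefXn; case: eqP => _;
  [exact: residue1|exact: residue0]. Qed.

Lemma residue_poly_comp Q R : (forall k, F Q`_k) -> (forall k, F R`_k) ->
  forall k, F (Q \Po R)`_k.
Proof.
elim/poly_ind: Q => [|Q c IH] FQ FR; first by rewrite comp_poly0 => k;
  rewrite coef0; exact: residue0.
rewrite comp_poly_MXaddC; apply: residue_poly_add.
  apply: residue_poly_mul => //; apply: IH => // k.
  by have := FQ k.+1; rewrite coefD coefMX coefC /= addr0.
by apply: residue_poly_const; have := FQ 0%N;
  rewrite coefD coefMX coefC /= add0r.
Qed.

(** The data points on the supporting line are those indexed by the support of [D], so the component
    depends on the key polynomial only through that support. *)
Lemma S_graded g D : g != 0 ->
  (forall k, D`_k != 0 <-> coef_exp (phi i.+1) g k != 0 /\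
     mu i (coef_exp (phi i.+1) g k * phi i.+1 ^+ k)%:F + k%:R * nu i.+1 =
     mu i.+1 g%:F) ->
  S_ mu phi nu i.+1 g = convex_hull
    [set (k%:R, mu i.+1 g%:F - k%:R * nu i.+1)
    | k in [set k : nat | D`_k != 0]]%classic.
Proof.
move=> g0 DP; have [[s /= cs0 es] lb] := aug g0.
rewrite /S_ /newton_polygon /=.
rewrite (@slope_component_hull _ _ (mu i.+1 g%:F)
  (s%:R, mu i (coef_exp (phi i.+1) g s * phi i.+1 ^+ s)%:F)) /=.
- congr convex_hull; apply/seteqP;
  split=> [_ [[k /= ck0 <-] /= ek]|_ [k /= /DP[ck0 ek] <-]].
    exists k => /=; first by apply/DP; rewrite [k%:R * _]mulrC.
    by rewrite -ek [k%:R * _]mulrC addrK.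
  split; first by exists k; rewrite //= -ek addrK.
  by rewrite /= [nu _ * _]mulrC subrK.
- by move=> _ [k /= ck0 <-] /=; rewrite [nu _ * _]mulrC; apply: lb; exists k.
- by exists s.
by rewrite [nu _ * _]mulrC es.
Qed.

Lemma S_line g q : g != 0 -> S_ mu phi nu i.+1 g q ->
  q.2 + nu i.+1 * q.1 = mu i.+1 g%:F.
Proof.
move=> g0; have [D [_ _ DP]] := graded_expansion key nu_gt0 aug g0.
rewrite (S_graded g0 DP); apply: convex_hull_line => _ [k _ <-] /=.
by rewrite [nu _ * _]mulrC subrK.
Qed.

Lemma su_left_end g s u : g != 0 ->
  left_end (S_ mu phi nu i.+1 g) (s%:R, u%:~R / d%:R) ->
  s_ mu phi nu i.+1 g = s /\ u_ mu phi nu i.+1 g = u.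
Proof.
move=> g0 le; rewrite /s_ /u_; suff -> : su_ mu phi nu i.+1 g = (s, u) by [].
apply: xget_unique => [//|[s' u'] /= le'].
have [/eqP es /eqP eu] := left_end_uniq (fun q => @S_line g q g0) le' le.
move: es; rewrite eqr_nat => /eqP->; congr (_, _); apply/eqP.
by rewrite -(eqr_int rat); move: eu => /eqP /(mulIf _)->;
  rewrite ?invr_eq0 ?step_ram_neq0.
Qed.

Lemma R_unique g Q : (forall k, F Q`_k) ->
  H_ (mu i.+1) g = x ^+ s_ mu phi nu i.+1 g * p ^ u_ mu phi nu i.+1 g * Q.[y] ->
  R_ mu phi nu pi i.+1 g = Q.
Proof.
move=> FQ HQ; apply: xget_unique => [//|Q' /= [FQ' HQ']].
apply/eqP; rewrite -subr_eq0; apply/eqP/y_transcendental.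
  by move=> k; rewrite coefB; apply: residue_sub.
rewrite hornerD hornerN; apply/eqP; rewrite subr_eq0; apply/eqP.
move: HQ'; rewrite HQ => /mulfI->//.
rewrite mulf_neq0 ?expf_neq0 ?x_neq0 //.
by apply: contraTneq (unitrXz (u_ mu phi nu i.+1 g) (cd_unit data)) => ->;
  rewrite unitr0.
Qed.

(** What the choice in [R_] yields once a suitable polynomial exists; the nonzero constant
    coefficient reflects that [s_] is the left end. *)
Record residual_data g : Prop := ResidualData {
  rd_coef : forall k, F (R_ mu phi nu pi i.+1 g)`_k;
  rd_coef0 : (R_ mu phi nu pi i.+1 g)`_0 != 0;
  rd_H : H_ (mu i.+1) g = x ^+ s_ mu phi nu i.+1 g *
    p ^ u_ mu phi nu i.+1 g * (R_ mu phi nu pi i.+1 g).[y];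
  rd_val : (u_ mu phi nu i.+1 g)%:~R =
    d%:R * (mu i.+1 g%:F - (s_ mu phi nu i.+1 g)%:R * nu i.+1) }.

(** The support of [D] lies in one residue class modulo [e], so [D] is ['X^s] times a polynomial in
    ['X^e]. Scaling its coefficients by powers of [p] to degree 0 gives the residual polynomial. *)
Lemma residualP g : g != 0 -> residual_data g.
Proof.
move=> g0; have [D [gD HD DP]] := graded_expansion key nu_gt0 aug g0.
set alpha := mu i.+1 g%:F in gD DP.
have D0 : D != 0.
  by apply: contraNneq (H_neq0 (mu i.+1) g0) => D0; rewrite HD D0 horner0.
have exD : exists k, D`_k != 0.
  by exists (size D).-1; rewrite -lead_coefE lead_coef_eq0.
case: (ex_minnP exD) => s Ds smin.
have valD k : D`_k != 0 -> exists z : int, alpha - k%:R * beta = z%:~R / d%:R.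
  case: (gD k) => [->|[a [a0 sa <- _]] _]; first by rewrite eqxx.
  rewrite (aug_small key nu_gt0 aug sa a0); have [_ Gd] := cd_pred data.
  by apply/Gd; exists a%:F => //=; rewrite tofrac_eq0.
have [z0 ez0] := valD s Ds.
have eR : e%:R != 0 :> rat by rewrite pnatr_eq0 -lt0n step_e_gt0.
have dR := step_ram_neq0.
have betaE : beta = (V%:~R * e%:R + h%:~R) / (e%:R * d%:R).
  by rewrite (cd_V data) step_nu /=; field; rewrite eR dR.
(* Both [alpha - k * beta] and [alpha - s * beta] are multiples of [1 / d], so [e] divides
   [(k - s) * h], and [h] is prime to [e]. *)
have e_dvd k : D`_k != 0 -> (e %| k - s)%N.
  move=> Dk; have sk := smin k Dk; have [z ez] := valD k Dk.
  have E : (k - s)%N%:Z * h = e%:Z * (z0 - z - (k - s)%N%:Z * V).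
    apply/eqP; rewrite -(eqr_int rat) !intrM !intrB intrM -!pmulrn natrB //.
    have ez0' : z0%:~R = d%:R * (alpha - s%:R * beta) by rewrite ez0 mulrC
      divfK.
    have ez' : z%:~R = d%:R * (alpha - k%:R * beta) by rewrite ez mulrC divfK.
    by rewrite ez0' ez' betaE; apply/eqP; field; rewrite eR dR.
  have : (e%:Z %| (k - s)%N%:Z * h)%Z by rewrite E dvdz_mulr.
  by rewrite Gauss_dvdzl // coprimez_sym (cd_coprime data).
pose m := V * e%:Z + h.
pose R' := \poly_(t < size D) D`_(s + e * t).
have R'E t : R'`_t = D`_(s + e * t).
  rewrite coef_poly; case: ltnP => // le_t; rewrite nth_default //.
  by rewrite (leq_trans le_t) // (leq_trans _ (leq_addl _ _)) // leq_pmull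
    ?step_e_gt0.
have DE : D = 'X^s * (R' \Po 'X^e).
  apply/polyP => k; rewrite coefXnM; case: ltnP => [ks|sk].
    by apply/eqP; apply: contraTT ks => /smin; rewrite -leqNgt.
  rewrite coef_comp_poly_Xn ?step_e_gt0 // R'E.
  case: ifP => [dv|ndv]; first by rewrite mulnC divnK // subnKC.
  by apply/eqP; apply: contraFT ndv => /e_dvd.
(* The coefficient of index [s + e * t] has degree [(z0 - m * t) / d], which these powers of [p]
   bring to 0. *)
pose R := \poly_(t < size D) (R'`_t * (p ^ (- z0) * (p ^ m) ^+ t)).
have RE t : R`_t = R'`_t * (p ^ (- z0) * (p ^ m) ^+ t).
  by rewrite coef_poly; case: ltnP => // le_t;
    rewrite coef_poly ltnNge le_t mul0r.
have up := cd_unit data.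
have FR t : F R`_t.
  apply/residueP; rewrite RE R'E.
  case: (gD (s + e * t)%N) => [->|sD]; [by left; rewrite mul0r|right].
  have := small_class_mul key nu_gt0 aug sD
    (small_class_mul key nu_gt0 aug (cd_p data (- z0))
      (small_classX key nu_gt0 aug t (cd_p data m))).
  congr (small_class _ _ _).
  rewrite intrN mulNr -ez0 -step_key_val natrD natrM.
  by ring.
have HR : H_ (mu i.+1) g = x ^+ s * p ^ (z0 + s%:Z * V) * R.[y].
  have R'y : R'.[Hphi ^+ e] = p ^ z0 * R.[y].
    rewrite !horner_poly mulr_sumr; apply: eq_bigr => t _.
    rewrite y_key -/m exprMn [(p ^ (- m)) ^+ t]exprnP [(p ^ m) ^+ t]exprnP
      !exprz_exp.
    have pp a : p ^ a * p ^ (- a) = 1 by rewrite -exprzDr // subrr expr0z.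
    transitivity (D`_(s + e * t) * (Hphi ^+ e) ^+ t * (p ^ z0 * p ^ (- z0)) *
      (p ^ (m * t) * p ^ (- (m * t)))); first by rewrite !pp !mulr1.
    have regroup (A : comNzRingType) (a b c c' f f' : A) :
      a * b * (c * c') * (f * f') = c * (a * (c' * f) * (b * f')) by ring.
    by rewrite R'E mulNr; exact: regroup.
  rewrite HD DE hornerM hornerXn horner_comp hornerXn R'y Hphi_x exprMn.
  by rewrite [(p ^ V) ^+ s]exprnP exprz_exp exprzDr // [s%:Z * V]mulrC -!mulrA;
    congr (_ * _); rewrite mulrCA.
have uE : (z0 + s%:Z * V)%:~R / d%:R = alpha - s%:R * nu i.+1.
  rewrite intrD mulrDl -ez0 (cd_V data) /= intrM -pmulrn; ring.
have le_s : left_end (S_ mu phi nu i.+1 g) (s%:R, (z0 + s%:Z * V)%:~R / d%:R).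
  rewrite (S_graded g0 DP); apply: left_end_hull.
    by exists s => //; rewrite uE.
  by move=> _ [k /= /smin sk <-] /=; rewrite ler_nat.
have [es eu] := su_left_end g0 le_s.
have eRg : R_ mu phi nu pi i.+1 g = R by apply: R_unique; rewrite ?es ?eu.
split; rewrite ?eRg ?es ?eu //; last first.
  by rewrite -[X in d%:R * (X - _)]/alpha -uE [RHS]mulrC divfK.
rewrite RE R'E muln0 addn0 expr0 mulr1 mulf_neq0 //.
by apply: contraTneq (unitrXz (- z0) up) => ->; rewrite unitr0.
Qed.

(** For [e = 1], [x] is [y * p ^ h], so [x ^ s] can be traded for [y ^ s]. The total exponent of [p]
    becomes [h * s + u], which depends only on the value of [g] and is therefore common to both
    chains. *)
Lemma residual_e1 g (z : int) :
  e = 1%N -> g != 0 -> z%:~R = d%:R * mu i.+1 g%:F ->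
  H_ (mu i.+1) g =
  p ^ z * ('X^(s_ mu phi nu i.+1 g) * R_ mu phi nu pi i.+1 g).[y].
Proof.
move=> e1 g0 ez; have [_ _ -> uE] := residualP g0.
set s := s_ _ _ _ _ _ in uE *; set u := u_ _ _ _ _ _ in uE *.
have up := cd_unit data; have pp a : p ^ (- a) * p ^ a = 1.
  by rewrite -exprzDr // addNr expr0z.
have xE : x = y * p ^ h by rewrite /y_ e1 expr1 -mulrA pp mulr1.
have -> : z = h * s%:Z + u.
  apply/eqP; rewrite -(eqr_int rat) ez intrD uE intrM step_nu e1 -pmulrn.
  by apply/eqP; field; rewrite step_ram_neq0.
rewrite xE exprMn [(p ^ h) ^+ s]exprnP exprz_exp exprzDr // hornerM hornerXn.
by rewrite -!mulrA mulrCA; congr (_ * _); rewrite mulrCA.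
Qed.

End FinalStep.

(** * Two key polynomials defining the same augmentation *)

Lemma p_same_keys (K : fieldType) (pi : K)
    (mu : nat -> valuation {fraction {poly K}} rat) (phi phi' : nat -> {poly
      K}) nu r :
  (forall i, (i < r)%N -> phi' i = phi i) ->
  p_ mu phi' nu pi r = p_ mu phi nu pi r.
Proof.
elim: r => [//|r IH] same; have phiE := same r (ltnSn r).
have pE := IH (fun j jr => same j (ltnW jr)).
have VE : V_ mu phi' r = V_ mu phi r by rewrite /V_ phiE.
by rewrite [LHS]/= pE VE phiE.
Qed.

Section TwoKeys.
Variables (K : fieldType) (mu mu' : valuation {fraction {poly K}} rat) (nu :
  rat).
Hypothesis nu_gt0 : 0 < nu.
Implicit Types phi psi : {poly K}.

(** If [psi] had smaller degree than [phi], its value would stay the same when seen from [phi], yet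
    grow by [nu] when seen from [psi]. *)
Lemma aug_key_size_le phi psi :
  key_polynomial mu phi -> is_augmentation mu phi nu mu' ->
  key_polynomial mu psi -> is_augmentation mu psi nu mu' ->
  (size phi <= size psi)%N.
Proof.
move=> kphi aphi kpsi apsi; rewrite leqNgt; apply/negP => s_lt.
have := aug_small kphi nu_gt0 aphi s_lt (key_neq0 kpsi).
by rewrite (aug_key kpsi apsi); move: nu_gt0; lra.
Qed.

(** If [psi] had larger value, [phi - psi] would share the value of [phi] under both valuations,
    hence gain [nu], which its low degree forbids. *)
Lemma aug_key_val_le phi psi :
  key_polynomial mu phi -> is_augmentation mu phi nu mu' ->
  key_polynomial mu psi -> is_augmentation mu psi nu mu' ->
  (size (psi - phi)%R < size phi)%N -> mu psi%:F <= mu phi%:F.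
Proof.
move=> kphi aphi kpsi apsi s_lt; rewrite leNgt; apply/negP => v_lt.
have phi0 := key_neq0 kphi; have psi0 := key_neq0 kpsi.
have [|n0 v1 _] := @H_eq _ mu phi (phi - psi) phi0.
  by rewrite subKr in_Pplus_nz.
have [|_ v2 _] := @H_eq _ mu' phi (phi - psi) phi0.
  rewrite subKr in_Pplus_nz // (aug_key kphi aphi) (aug_key kpsi apsi).
  by rewrite ltrD2r.
have := aug_small kphi nu_gt0 aphi _ n0;
  rewrite v1 v2 -opprB size_polyN => /(_ s_lt).
by rewrite (aug_key kphi aphi); move: nu_gt0; lra.
Qed.

Lemma aug_key_same phi psi :
  key_polynomial mu phi -> is_augmentation mu phi nu mu' ->
  key_polynomial mu psi -> is_augmentation mu psi nu mu' ->
  [/\ size psi = size phi, (size (psi - phi)%R < size phi)%N,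
      mu psi%:F = mu phi%:F & mu' psi%:F = mu' phi%:F].
Proof.
move=> kphi aphi kpsi apsi.
have sE : size psi = size phi by apply/eqP; rewrite eqn_leq !aug_key_size_le.
have [[mphi _ _ _ _] [mpsi _ _ _ _]] := (kphi, kpsi).
have s_lt : (size (psi - phi)%R < size phi)%N.
  rewrite ltnNge; apply/negP => s_ge.
  have phi_gt0 : (0 < size phi)%N by rewrite size_poly_gt0 (key_neq0 kphi).
  have sz : size (psi - phi) = size phi.
    apply/eqP; rewrite eqn_leq s_ge andbT.
    by rewrite (leq_trans (size_polyD _ _)) // size_polyN sE maxnn.
  have : lead_coef (psi - phi) = 0.
    rewrite lead_coefE sz coefB -{1}sE -!lead_coefE.
    by rewrite (monicP mphi) (monicP mpsi) subrr.
  move/eqP; rewrite lead_coef_eq0 => /eqP e0; move: sz phi_gt0.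
  by rewrite e0 size_poly0 => <-.
have vE : mu psi%:F = mu phi%:F.
  apply/eqP; rewrite eq_le (aug_key_val_le kphi aphi) //=.
  by apply: (aug_key_val_le kpsi apsi) => //; rewrite -opprB size_polyN sE.
by split; rewrite // (aug_key kphi aphi) (aug_key kpsi apsi) vE.
Qed.

End TwoKeys.

(** * Comparison of the operators of the two chains *)

Section TwoChains.
Variables (K : fieldType) (pi : K) (i : nat).
Variables (mu : nat -> valuation {fraction {poly K}} rat).
Variables (phi phi' : nat -> {poly K}) (nu : nat -> rat).
Hypothesis same_keys : forall j, (j < i.+1)%N -> phi' j = phi j.
Hypothesis key : key_polynomial (mu i) (phi i.+1).
Hypothesis key' : key_polynomial (mu i) (phi' i.+1).
Hypothesis nu_gt0 : 0 < nu i.+1.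
Hypothesis aug : is_augmentation (mu i) (phi i.+1) (nu i.+1) (mu i.+1).
Hypothesis aug' : is_augmentation (mu i) (phi' i.+1) (nu i.+1) (mu i.+1).
Hypothesis data : chain_data pi mu phi nu i.+1.
Hypothesis data' : chain_data pi mu phi' nu i.+1.

Notation d := (ramification (mu i)).
Notation e := (e_ mu i.+1).
Notation h := (h_ mu nu i.+1).
Notation V := (V_ mu phi i.+1).
Notation p := (p_ mu phi nu pi i.+1).
Notation x := (x_ mu phi nu pi i.+1).
Notation y := (y_ mu phi nu pi i.+1).
Notation a := (phi' i.+1 - phi i.+1).

Lemma same_p : p_ mu phi' nu pi i.+1 = p.
Proof. exact: p_same_keys. Qed.

Lemma same_V : V_ mu phi' i.+1 = V.
Proof.
by rewrite /V_ /=; have [_ _ -> _] := aug_key_same nu_gt0 key aug key' aug'.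
Qed.

(** Both graded expansions of [g] are homogeneous polynomials evaluated at the same class, so they
    coincide by [graded_poly_root], and [S_] is determined by their support. *)
Lemma S_mu_equiv g : mu_equiv (mu i.+1) (phi' i.+1) (phi i.+1) -> g != 0 ->
  S_ mu phi' nu i.+1 g = S_ mu phi nu i.+1 g.
Proof.
move=> eqv g0; have [sE _ _ vE] := aug_key_same nu_gt0 key aug key' aug'.
have [D [gD HD DP]] := graded_expansion key nu_gt0 aug g0.
have [D' [gD' HD' DP']] := graded_expansion key' nu_gt0 aug' g0.
have gD'2 : graded_poly (phi i.+1) (mu i.+1 g%:F) D'.
  move=> k; have [->|[b [b0 sb vb eb]]] := gD' k; [by left|right].
  by exists b; split; rewrite // -?sE // -vE.
have DE : D = D'.
  apply/eqP; rewrite -subr_eq0; apply/eqP.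
  apply: (graded_poly_root key aug (graded_poly_sub key gD gD'2)).
  by rewrite hornerD hornerN -HD -eqv -HD' subrr.
by rewrite (S_graded aug g0 DP) (S_graded aug' g0 DP') DE.
Qed.

Hypothesis neqv : ~ mu_equiv (mu i.+1) (phi' i.+1) (phi i.+1).

Lemma diff_data : [/\ a != 0, (size a < size (phi i.+1))%N,
  mu i.+1 a%:F = mu i.+1 (phi i.+1)%:F &
  H_ (mu i.+1) (phi' i.+1) = H_ (mu i.+1) (phi i.+1) + H_ (mu i.+1) a].
Proof.
have [sE s_lt _ vE] := aug_key_same nu_gt0 key aug key' aug'.
have a0 : a != 0.
  by apply/eqP => /eqP; rewrite subr_eq0 => /eqP e0; apply: neqv; rewrite e0.
have phiP := in_P_val (mu i.+1) (phi i.+1).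
have phi'P : phi' i.+1 \in P_ (mu i.+1) (mu i.+1 (phi i.+1)%:F).
  by rewrite -vE in_P_val.
have aP : a \in P_ (mu i.+1) (mu i.+1 (phi i.+1)%:F) by rewrite P_D ?P_N.
have va : mu i.+1 a%:F = mu i.+1 (phi i.+1)%:F.
  apply/eqP; rewrite eq_le -[X in _ && X]in_P_nz // aP andbT leNgt;
    apply/negP => v_lt.
  apply: neqv; rewrite /mu_equiv.
  have [|_ _ ->//] := @H_eq _ (mu i.+1) (phi' i.+1) (phi i.+1) (key_neq0 key').
  by rewrite vE in_Pplus_nz.
split=> //; rewrite /H_ va vE -gr_classD //.
by rewrite addrC subrK.
Qed.

(** The low-degree polynomial [a] has the value of the key polynomial, which is therefore a multiple
    of [1 / d]. Hence [e] divides [V * e + h], so it divides [h], to which it is prime. *)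
Lemma diff_e1 : e = 1%N.
Proof.
have [a0 s_lt va _] := diff_data.
have [_ Gd] := cd_pred data.
have [z vz] : exists z : int, mu i.+1 a%:F = z%:~R / d%:R.
  rewrite (aug_small key nu_gt0 aug s_lt a0).
  by apply/Gd; exists a%:F => //=; rewrite tofrac_eq0.
have dR := step_ram_neq0 data; have e0 := step_e_gt0 data.
have : e%:R * mu i.+1 (phi i.+1)%:F = (V * e%:Z + h)%:~R / d%:R.
  exact: (step_key_val data).
rewrite -va vz mulrA => /(mulIf _) eqz.
have : (e%:Z * z)%:~R = (V * e%:Z + h)%:~R :> rat.
  by rewrite intrM -pmulrn eqz ?invr_eq0.
move=> /eqP; rewrite eqr_int => /eqP E.
have eh : (e%:Z %| h)%Z.
  have -> : h = e%:Z * (z - V) by lia.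
  exact: dvdz_mulr.
move: (cd_coprime data); rewrite coprimez_sym coprimezE /coprime.
by move: eh; rewrite dvdzE => /gcdn_idPl ->; rewrite absz_nat => /eqP.
Qed.

Notation eta := (H_ (mu i.+1) a * p ^ (- (V + h))).

(** With [e = 1], the class of [a] has degree [(V + h) / d], and the power of [p] in [eta] brings it
    to degree 0. *)
Lemma eta_residue : F_ mu i.+1 eta.
Proof.
have [a0 s_lt va _] := diff_data.
apply/(residueP key nu_gt0 aug); right.
have sa : small_class (phi i.+1) (H_ (mu i.+1) a) (mu i.+1 a%:F) by exists a.
have := small_class_mul key nu_gt0 aug sa (cd_p data (- (V + h))).
congr (small_class _ _ _); rewrite va intrN mulNr.
have := step_key_val data; rewrite diff_e1 mul1r mulr1 => ->.
by rewrite subrr.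
Qed.

Lemma eta_neq0 : eta != 0.
Proof.
have [a0 _ _ _] := diff_data; rewrite mulf_neq0 ?H_neq0 //.
by apply: contraTneq (unitrXz (- (V + h)) (cd_unit data)) => ->; rewrite unitr0.
Qed.

Lemma same_x_shift : x_ mu phi' nu pi i.+1 = x + p ^ h * eta.
Proof.
have [_ _ _ Hphi'] := diff_data; have up := cd_unit data.
rewrite /x_ same_V same_p Hphi' mulrDl; congr (_ + _).
by rewrite mulrCA -exprzDr //; congr (_ * p ^ _); lia.
Qed.

Lemma same_y_shift : y_ mu phi' nu pi i.+1 = y + eta.
Proof.
have up := cd_unit data.
rewrite /y_ same_x_shift same_p diff_e1 !expr1 mulrDl; congr (_ + _).
by rewrite mulrAC -exprzDr // subrr expr0z mul1r.
Qed.

(** Transcendence of [y] turns [residual_e1] for [a] into ['X^s * R = eta%:P]; as [eta] is nonzero,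
    [s] must be 0. *)
Lemma R_diff : R_ mu phi nu pi i.+1 a = eta%:P.
Proof.
have [a0 s_lt va _] := diff_data;
  have [FR R0 _ _] := residualP key nu_gt0 aug data a0.
have up := cd_unit data.
have vz : (V + h)%:~R = d%:R * mu i.+1 a%:F.
  have := step_key_val data; rewrite diff_e1 mul1r mulr1 va => ->.
  by rewrite mulrC divfK ?(step_ram_neq0 data).
have := residual_e1 key nu_gt0 aug data diff_e1 a0 vz.
set s := s_ _ _ _ _ _; set R := R_ _ _ _ _ _ _ => HE.
have E : 'X^s * R - eta%:P = 0.
  apply: (y_transcendental key nu_gt0 aug data).
    move=> k; rewrite coefB; apply: (residue_sub key nu_gt0 aug).
      exact: (residue_poly_mul key nu_gt0 aug (residue_polyXn key nu_gt0 aug s)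
        FR).
    exact: (residue_poly_const key nu_gt0 aug eta_residue).
  rewrite hornerD hornerN hornerC HE mulrAC -exprzDr // subrr expr0z mul1r.
  by rewrite subrr.
move/eqP: E; rewrite subr_eq0 => /eqP E.
case: (s) E => [|n]; first by rewrite expr0 mul1r.
move=> /(congr1 (fun P : {poly _} => P`_0)); rewrite coefXnM coefC /= => /eqP.
by rewrite eq_sym (negPf eta_neq0).
Qed.

(** The two forms of [residual_e1] share the factor [p ^ z]. Cancelling it and using the
    transcendence of [y] gives the identity required by [shifted_residual]. *)
Lemma R_shift g : g != 0 ->
  let s := ord_ ('X + eta%:P) (R_ mu phi nu pi i.+1 g) in
  let P := R_ mu phi nu pi i.+1 g %/ ('X + eta%:P) ^+ s in
  s_ mu phi' nu i.+1 g = s /\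
  R_ mu phi' nu pi i.+1 g = ('X - eta%:P) ^+ s_ mu phi nu i.+1 g * (P \Po ('X -
    eta%:P)).
Proof.
move=> g0 /=.
have [FR R0 _ _] := residualP key nu_gt0 aug data g0.
have [FR' R0' _ _] := residualP key' nu_gt0 aug' data' g0.
have [_ Gd] := cd_ram data.
have [z vz] : exists z : int, z%:~R = d%:R * mu i.+1 g%:F.
  have [z ->] : exists z : int, mu i.+1 g%:F = z%:~R / (ramification (mu
    i.+1))%:R.
    by apply/Gd; exists g%:F => //=; rewrite tofrac_eq0.
  exists z; rewrite (cd_e data) diff_e1 mul1n mulrC divfK //.
  exact: (step_ram_neq0 data).
have HE := residual_e1 key nu_gt0 aug data diff_e1 g0 vz.
have HE' := residual_e1 key' nu_gt0 aug' data' diff_e1 g0 vz.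
have up := cd_unit data.
have Fshift := residue_poly_add key nu_gt0 aug (residue_polyXn key nu_gt0 aug 1)
  (residue_poly_const key nu_gt0 aug eta_residue).
move: HE HE' R0 R0' FR FR'; rewrite same_y_shift same_p.
set s := s_ mu phi nu _ _; set s' := s_ mu phi' nu _ _.
set R := R_ mu phi nu _ _ _;
  set R' := R_ mu phi' nu _ _ _ => HE HE' R0 R0' FR FR'.
have E : 'X^s * R - (('X^s' * R') \Po ('X + eta%:P)) = 0.
  apply: (y_transcendental key nu_gt0 aug data).
    move=> k; rewrite coefB; apply: (residue_sub key nu_gt0 aug).
      exact: (residue_poly_mul key nu_gt0 aug (residue_polyXn key nu_gt0 aug s)
        FR).
    apply: (residue_poly_comp key nu_gt0 aug _ Fshift).
    exact: (residue_poly_mul key nu_gt0 aug (residue_polyXn key nu_gt0 aug s')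
      FR').
  rewrite hornerD hornerN horner_comp hornerD hornerX hornerC.
  apply/eqP; rewrite subr_eq0; apply/eqP.
  by apply: (mulrI (unitrXz z up)); rewrite -HE -HE'.
move/eqP: E; rewrite subr_eq0 => /eqP E.
have Rn0 : R != 0 by apply: contraNneq R0 => ->; rewrite coef0.
have [es eR] := shifted_residual eta_neq0 Rn0 R0' E.
by rewrite -es.
Qed.

End TwoChains.

Theorem theorem3p7 (K : fieldType) (v : valuation K int) (pi : K)
    (v_surj : forall z : int, exists2 a : K, a != 0 & v a = z)
    (pi_gen : generates_maximal_ideal v pi)
    (r : nat) (r_gt0 : (1 <= r)%N)
    (mu : nat -> valuation {fraction {poly K}} rat)
    (phi phi' : nat -> {poly K}) (nu : nat -> rat)
    (chain : maclane_chain v r mu phi nu)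
    (chain' : maclane_chain v r mu phi' nu)
    (same_keys : forall i : nat, (i < r)%N -> phi' i = phi i) :
  (mu_equiv (mu r) (phi' r) (phi r) ->
     [/\ p_ mu phi' nu pi r = p_ mu phi nu pi r,
         x_ mu phi' nu pi r = x_ mu phi nu pi r,
         y_ mu phi' nu pi r = y_ mu phi nu pi r,
         forall g : {poly K}, g != 0 -> S_ mu phi' nu r g = S_ mu phi nu r g &
         forall g : {poly K}, g != 0 ->
           R_ mu phi' nu pi r g = R_ mu phi nu pi r g])
  /\
  (~ mu_equiv (mu r) (phi' r) (phi r) ->
     exists eta : Gr (mu r),
       [/\ F_ mu r eta, eta != 0,
           R_ mu phi nu pi r (phi' r - phi r) = eta%:P &
           [/\ p_ mu phi' nu pi r = p_ mu phi nu pi r,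
               x_ mu phi' nu pi r =
                 x_ mu phi nu pi r + p_ mu phi nu pi r ^ h_ mu nu r * eta,
               y_ mu phi' nu pi r = y_ mu phi nu pi r + eta &
               forall g : {poly K}, g != 0 ->
                 let s := ord_ ('X + eta%:P) (R_ mu phi nu pi r g) in
                 let P := R_ mu phi nu pi r g %/ ('X + eta%:P) ^+ s in
                 s_ mu phi' nu r g = s /\
                 R_ mu phi' nu pi r g =
                   ('X - eta%:P) ^+ s_ mu phi nu r g
                     * (P \Po ('X - eta%:P))]]).
Proof.
case: r r_gt0 chain chain' same_keys => [//|i] _ chain chain' same_keys.
have data := chain_dataP v_surj pi_gen chain (leqnn i.+1).
have data' := chain_dataP v_surj pi_gen chain' (leqnn i.+1).
have [_ _ _ _ /(_ i (ltnSn i))[key nu_gt0 aug _]] := chain.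
have [_ _ _ _ /(_ i (ltnSn i))[key' _ aug' _]] := chain'.
have pE := same_p pi mu nu same_keys.
split=> [eqv|neqv].
  have xE : x_ mu phi' nu pi i.+1 = x_ mu phi nu pi i.+1.
    by rewrite /x_ pE (same_V key key' nu_gt0 aug aug') eqv.
  have yE : y_ mu phi' nu pi i.+1 = y_ mu phi nu pi i.+1 by rewrite /y_ xE pE.
  have SE g := S_mu_equiv key key' nu_gt0 aug aug' (g := g) eqv.
  split; [exact: pE|exact: xE|exact: yE|exact: SE|move=> g g0].
  (* [su_] is read off [S_], and [R_] is chosen by a condition on [x_], [p_], [y_] and [su_], so
     agreement of these data suffices. *)
  have suE : su_ mu phi' nu i.+1 g = su_ mu phi nu i.+1 g by rewrite /su_ SE.
  by rewrite /R_ xE yE pE /s_ /u_ suE.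
exists (H_ (mu i.+1) (phi' i.+1 - phi i.+1) *
        p_ mu phi nu pi i.+1 ^ (- (V_ mu phi i.+1 + h_ mu nu i.+1))).
split; [exact: eta_residue|exact: eta_neq0|exact: R_diff|].
split; [exact: pE|exact: same_x_shift|exact: same_y_shift|exact: R_shift].
Qed.
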